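(* Let $M$ and $N$ be second-countable manifolds and let $\pi:M\times N\to M$ be the trivial bundle over $M$ with fiber $N$. The triple $(\mathrm{Dirac}_\pi(M\times N),\Delta,\epsilon)$ is a cocommutative, locally convex coalgebra over $C^\infty_c(M)$, in the sense that (it is a cocommutative coalgebra over $C^\infty_c(M)$ and) $\Delta$ and $\epsilon$ are continuous maps, where $\mathrm{Dirac}_\pi(M\times N)\otimes_{C^\infty_c(M)}\mathrm{Dirac}_\pi(M\times N)$ carries the $C^\infty_c(M)$-injective topology.
   Context: Manifolds are smooth, Hausdorff and paracompact; functions are $\mathbb C$-valued. $C^\infty(M\times N)$ has the Fréchet topology of uniform convergence of all derivatives on compact sets; $C^\infty_c(M)$ has the LF-topology (inductive limit of the Fréchet spaces $C^\infty_c(L)$, $L\subset M$ compact). $C^\infty(M\times N)$ is a $C^\infty_c(M)$-module by $(f\cdot F)(x,y)=f(x)F(x,y)$. $\mathcal E'_\pi(M\times N)=\mathrm{Hom}_{C^\infty_c(M)}(C^\infty(M\times N),C^\infty_c(M))$ (continuous $C^\infty_c(M)$-linear maps) is a module by $(f\cdot T)(F)=T(f\cdot F)$ and has the strong topology of uniform convergence on bounded sets. For $y\in N$, $f\in C^\infty_c(M)$ let $\llbracket E_y,f\rrbracket(F)(x)=f(x)F(x,y)$. $D:=\mathrm{Dirac}_\pi(M\times N)$ is the set of all finite sums $\sum_i\llbracket E_{y_i},f_i\rrbracket$, with the topology induced from $\mathcal E'_\pi(M\times N)$; the representation with distinct $y_i$ is unique up to zero terms. The structure maps $\Delta:D\to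 D\otimes_{C^\infty_c(M)}D$ and $\epsilon:D\to C^\infty_c(M)$ are $$\Delta\Big(\sum_i\llbracket E_{y_i},f_i\rrbracket\Big)=\sum_i\llbracket E_{y_i},f_i\rrbracket\otimes\llbracket E_{y_i},1_{f_i}\rrbracket,\qquad \epsilon\Big(\sum_i\llbracket E_{y_i},f_i\rrbracket\Big)=\sum_if_i,$$ where $1_f\in C^\infty_c(M)$ is any function with $1_ff=f$ (the choice does not matter). $C^\infty_c(M)$-injective topology on $D\otimes_{C^\infty_c(M)}D$: for $F,G\in C^\infty(M\times N)$ put $(F\otimes G)(\sum_iu_i'\otimes u_i'')=\sum_iu_i'(F)u_i''(G)\in C^\infty_c(M)$. Basic neighbourhoods of zero are $K(A,B,V)=\{\tilde u:(F\otimes G)(\tilde u)\in V\text{ for }F\in A,G\in B\}$, with $A,B\subset C^\infty(M\times N)$ bounded and $V$ a neighbourhood of zero in $C^\infty_c(M)$. A coalgebra over a commutative $\mathbb C$-algebra $R$ with local identities (for $r_1,\dots,r_n\in R$ there is $r\in R$ with $rr_i=r_i$ for all $i$) is a left $R$-module $C$ which is locally unitary (for $c_1,\dots,c_n\in C$ there is $r\in R$ with $rc_i=c_i$ for all $i$), with $R$-linear maps $\Delta:C\to C\otimes_RC$, $\epsilon:C\to R$ such that $(\mathrm{id}\otimes\epsilon)\circ\Delta=\mathrm{id}=(\epsilon\otimes\mathrm{id})\circ\Delta$ (using $C\cong R\otimes_RC\cong C\otimes_RR$) and $(\mathrm{id}\otimes\Delta)\circ\Delta=(\Delta\otimes\mathrm{id})\circ\Delta$.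 It is cocommutative if $\sigma\circ\Delta=\Delta$ for the flip $\sigma(c\otimes c')=c'\otimes c$. *)

(* Defs.v *)
From HB Require Import structures.
From mathcomp Require Import all_boot all_order all_algebra.
From mathcomp Require Import all_classical all_reals all_analysis.
From mathcomp Require Import complex.
From Stdlib Require List.

Set Implicit Arguments.
Unset Strict Implicit.
Unset Printing Implicit Defensive.

Import Order.TTheory GRing.Theory Num.Theory.
Import numFieldNormedType.Exports.
Local Open Scope classical_set_scope.
Local Open Scope quotient_scope.
Local Open Scope ring_scope.

(* Commutative rings which need not have a unit (C^oo_c(M) has one only if M is
   compact) and their modules.  The scalar action of a base field plays no role
   in the notion of a coalgebra, so it is not part of these structures. *)

HB.mixin Record Zmodule_isNuComRing A & GRing.Zmodule A := {
  numul : A -> A -> A ;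
  numulA : associative numul ;
  numulC : commutative numul ;
  numulDl : left_distributive numul +%R
}.

#[short(type="nuComRingType")]
HB.structure Definition NuComRing :=
  {A of GRing.Zmodule A & Zmodule_isNuComRing A}.

HB.mixin Record Zmodule_isNuModule (R : nuComRingType) V
    & GRing.Zmodule V := {
  nuact : R -> V -> V ;
  nuactA : forall r s v, nuact r (nuact s v) = nuact (numul r s) v ;
  nuactDl : forall v, {morph nuact^~ v : r s / r + s} ;
  nuactDr : forall r, {morph nuact r : v w / v + w}
}.

#[short(type="nuModType")]
HB.structure Definition NuModule (R : nuComRingType) :=
  {V of GRing.Zmodule V & Zmodule_isNuModule R V}.

Section NuTheory.
Variables (R : nuComRingType) (V : nuModType R).

Lemma nuact0r (r : R) : nuact r (0 : V) = 0.
Proof. by apply: (@addrI _ (nuact r 0)); rewrite -nuactDr !addr0. Qed.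

Lemma nuact0l (v : V) : nuact (0 : R) v = 0.
Proof. by apply: (@addrI _ (nuact 0 v)); rewrite -nuactDl !addr0. Qed.

Lemma nuactN (r : R) (v : V) : nuact r (- v) = - nuact r v.
Proof. by apply/eqP; rewrite -addr_eq0 -nuactDr addNr nuact0r. Qed.

Lemma nuact_sum (r : R) I (s : seq I) (F : I -> V) :
  nuact r (\sum_(i <- s) F i) = \sum_(i <- s) nuact r (F i).
Proof.
elim: s => [|i s IH]; first by rewrite !big_nil nuact0r.
by rewrite !big_cons nuactDr IH.
Qed.

End NuTheory.

Definition nu_regular (R : Type) : Type := R.

Section Regular.
Variable R : nuComRingType.

HB.instance Definition _ := GRing.Zmodule.on (nu_regular R).

Fact nu_regularA (r s : R) (v : nu_regular R) :
  numul r (numul s v) = numul (numul r s) v.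
Proof. exact: numulA. Qed.
Fact nu_regularDl (v : nu_regular R) :
  {morph (fun r : R => numul r v : nu_regular R) : r s / r + s}.
Proof. by move=> r s; exact: numulDl. Qed.
Fact nu_regularDr (r : R) :
  {morph (numul r : nu_regular R -> nu_regular R) : v w / v + w}.
Proof. by move=> v w; rewrite numulC [LHS]numulDl !(numulC r). Qed.

HB.instance Definition _ := Zmodule_isNuModule.Build R (nu_regular R)
  nu_regularA nu_regularDl nu_regularDr.

End Regular.

Definition nu_linear (R : nuComRingType) (V W : nuModType R) (f : V -> W) :=
  {morph f : v w / v + w} /\ forall (r : R) v, f (nuact r v) = nuact r (f v).

Definition local_identities (R : nuComRingType) :=
  forall rs : seq R, exists r : R, forall s, s \in rs -> numul r s = s.

Definition locally_unitary (R : nuComRingType) (V : nuModType R) :=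
  forall vs : seq V, exists r : R, forall v, v \in vs -> nuact r v = v.

Section Tensor.
Variables (R : nuComRingType) (A B : nuModType R).
Implicit Types (a : A) (b : B) (s t u : seq (A * B)).

(* The list [:: (a1, b1); ...; (an, bn)] stands for the sum of the ai (x) bi;
   the additive inverse of (a, b) is (- a, b). *)
Inductive tens_rel : seq (A * B) -> seq (A * B) -> Prop :=
| tens_refl s : tens_rel s s
| tens_sym s t : tens_rel s t -> tens_rel t s
| tens_trans s t u : tens_rel s t -> tens_rel t u -> tens_rel s u
| tens_cat s s' t t' :
    tens_rel s s' -> tens_rel t t' -> tens_rel (s ++ t) (s' ++ t')
| tens_comm s t : tens_rel (s ++ t) (t ++ s)
| tens_0l b : tens_rel [:: (0, b)] [::]
| tens_Dl a a' b : tens_rel [:: (a + a', b)] [:: (a, b); (a', b)]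
| tens_Dr a b b' : tens_rel [:: (a, b + b')] [:: (a, b); (a, b')]
| tens_mid (r : R) a b : tens_rel [:: (nuact r a, b)] [:: (a, nuact r b)].

Definition tens_eqv s t := `[< tens_rel s t >].

Fact tens_eqv_equiv : equiv_class_of tens_eqv.
Proof.
split; first by move=> s; apply/asboolP; exact: tens_refl.
- by move=> s t; apply/asboolP/asboolP; exact: tens_sym.
- move=> s t u /asboolP st /asboolP tu; apply/asboolP.
  exact: tens_trans st tu.
Qed.

Canonical tens_equiv := EquivRelPack tens_eqv_equiv.

Definition tensor : Type := {eq_quot tens_equiv}.
HB.instance Definition _ := Choice.on tensor.
HB.instance Definition _ := EqQuotient.on tensor.

Definition tens_class s : tensor := \pi_tensor s.

Lemma tens_classP s t : tens_class s = tens_class t <-> tens_rel s t.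
Proof. by split => [/eqP|] H; [|apply/eqP]; rewrite ?eqmodE in H *; apply/asboolP. Qed.

Lemma tens_reprP s : tens_rel s (repr (tens_class s)).
Proof. by apply/tens_classP; rewrite /tens_class reprK. Qed.

Definition tens_add (x y : tensor) := tens_class (repr x ++ repr y).
Definition tens_opp (x : tensor) :=
  tens_class [seq (- p.1, p.2) | p <- repr x].
Definition tens_act (r : R) (x : tensor) :=
  tens_class [seq (nuact r p.1, p.2) | p <- repr x].

Lemma tensW (P : tensor -> Prop) :
  (forall s, P (tens_class s)) -> forall x, P x.
Proof. by move=> PP x; rewrite -[x]reprK; exact: PP. Qed.

Lemma tens_add_class s t : tens_add (tens_class s) (tens_class t) =
  tens_class (s ++ t).
Proof.
by apply/tens_classP; apply: tens_cat; apply: tens_sym; exact: tens_reprP.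
Qed.

Lemma tens_rel_map (f : A -> A) : {morph f : a a' / a + a'} ->
  (forall r a, f (nuact r a) = nuact r (f a)) -> forall s t, tens_rel s t ->
  tens_rel [seq (f p.1, p.2) | p <- s] [seq (f p.1, p.2) | p <- t].
Proof.
move=> fD fZ; have f0 : f 0 = 0 by apply: (@addrI _ (f 0)); rewrite -fD !addr0.
move=> s t; elim=> {s t} /=.
- by move=> s; exact: tens_refl.
- by move=> s t _; exact: tens_sym.
- by move=> s t u _ + _; exact: tens_trans.
- by move=> s s' t t' _ + _; rewrite !map_cat; exact: tens_cat.
- by move=> s t; rewrite !map_cat; exact: tens_comm.
- by move=> b; rewrite f0; exact: tens_0l.
- by move=> a a' b; rewrite fD; exact: tens_Dl.
- by move=> a b b'; exact: tens_Dr.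
- by move=> r a b; rewrite fZ; exact: tens_mid.
Qed.

Lemma tens_opp_class s :
  tens_opp (tens_class s) = tens_class [seq (- p.1, p.2) | p <- s].
Proof.
apply/tens_classP; apply: (@tens_rel_map -%R).
- exact: opprD.
- by move=> r a; rewrite nuactN.
- by apply: tens_sym; exact: tens_reprP.
Qed.

Lemma tens_act_class r s :
  tens_act r (tens_class s) = tens_class [seq (nuact r p.1, p.2) | p <- s].
Proof.
apply/tens_classP; apply: (@tens_rel_map (nuact r)).
- exact: nuactDr.
- by move=> q a; rewrite !nuactA numulC.
- by apply: tens_sym; exact: tens_reprP.
Qed.

Lemma tens_rel_shuffle (p q : A * B) s t :
  tens_rel (p :: s ++ q :: t) ([:: p; q] ++ (s ++ t)).
Proof.
apply: (@tens_cat [:: p] [:: p] (s ++ [:: q] ++ t) ([:: q] ++ s ++ t)).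
  exact: tens_refl.
by rewrite !catA; apply: tens_cat; [exact: tens_comm|exact: tens_refl].
Qed.

Fact tens_addA : associative tens_add.
Proof.
elim/tensW=> s; elim/tensW=> t; elim/tensW=> u.
by rewrite !tens_add_class catA.
Qed.

Fact tens_addC : commutative tens_add.
Proof.
elim/tensW=> s; elim/tensW=> t; rewrite !tens_add_class.
by apply/tens_classP; exact: tens_comm.
Qed.

Fact tens_add0 : left_id (tens_class [::]) tens_add.
Proof. by elim/tensW=> s; rewrite tens_add_class. Qed.

Fact tens_addN : left_inverse (tens_class [::]) tens_opp tens_add.
Proof.
elim/tensW=> s; rewrite tens_opp_class tens_add_class; apply/tens_classP.
elim: s => [|[a b] s IH] /=; first exact: tens_refl.
apply: (tens_trans (tens_rel_shuffle _ _ _ _)).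
rewrite -[nil]cats0; apply: tens_cat IH.
apply: (@tens_trans _ [:: (- a + a, b)]); first by apply: tens_sym; exact: tens_Dl.
by rewrite addNr; exact: tens_0l.
Qed.

HB.instance Definition _ :=
  GRing.isZmodule.Build tensor tens_addA tens_addC tens_add0 tens_addN.

Fact tens_actA r q x : tens_act r (tens_act q x) = tens_act (numul r q) x.
Proof.
elim/tensW: x => s; rewrite !tens_act_class -map_comp; congr tens_class.
by apply: eq_map => p /=; rewrite nuactA.
Qed.

Fact tens_actDl x : {morph tens_act^~ x : r q / r + q}.
Proof.
move=> r q; elim/tensW: x => s; rewrite !tens_act_class [RHS]tens_add_class.
apply/tens_classP; elim: s => [|[a b] s IH] /=; first exact: tens_refl.
rewrite nuactDl -cat1s.
apply: (@tens_trans _ ([:: (nuact r a, b); (nuact q a, b)] ++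
  ([seq (nuact r p.1, p.2) | p <- s] ++ [seq (nuact q p.1, p.2) | p <- s]))).
  by apply: tens_cat IH; exact: tens_Dl.
by apply: tens_sym; exact: tens_rel_shuffle.
Qed.

Fact tens_actDr r : {morph tens_act r : x y / x + y}.
Proof.
elim/tensW=> s; elim/tensW=> t; rewrite [_ + _ in LHS]tens_add_class.
by rewrite !tens_act_class [RHS]tens_add_class map_cat.
Qed.

HB.instance Definition _ :=
  Zmodule_isNuModule.Build R tensor tens_actA tens_actDl tens_actDr.

Definition tens a b : tensor := tens_class [:: (a, b)].

(* The additive map sending a (x) b to f a b, for an R-balanced biadditive f;
   it does not depend on the chosen representative, see [tens_lift_class]. *)
Definition tens_lift (Z : zmodType) (f : A -> B -> Z) (x : tensor) : Z :=
  \sum_(p <- repr x) f p.1 p.2.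

Definition balanced (Z : zmodType) (f : A -> B -> Z) :=
  [/\ forall b, {morph f^~ b : a a' / a + a'},
      forall a, {morph f a : b b' / b + b'} &
      forall r a b, f (nuact r a) b = f a (nuact r b)].

Lemma tens_lift_class (Z : zmodType) (f : A -> B -> Z) s : balanced f ->
  tens_lift f (tens_class s) = \sum_(p <- s) f p.1 p.2.
Proof.
move=> [fDl fDr fm]; rewrite /tens_lift; have := tens_reprP s.
move: (repr _) => t; elim=> {s t} //.
- by move=> s t u _ <- _.
- by move=> s s' t t' _ + _; rewrite !big_cat /= => -> ->.
- by move=> s t; rewrite !big_cat /= addrC.
- move=> b; rewrite big_seq1 big_nil /=; apply/esym.
  by apply: (@addrI _ (f 0 b)); rewrite -fDl !addr0.
- by move=> a a' b; rewrite big_cons !big_seq1 /= fDl.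
- by move=> a b b'; rewrite big_cons !big_seq1 /= fDr.
- by move=> r a b; rewrite !big_seq1 /= fm.
Qed.

Lemma tens_liftD (Z : zmodType) (f : A -> B -> Z) : balanced f ->
  {morph tens_lift f : x y / x + y}.
Proof.
move=> bf; elim/tensW=> s; elim/tensW=> t.
by rewrite [_ + _ in LHS]tens_add_class !tens_lift_class// big_cat.
Qed.

Lemma tens_lift_tens (Z : zmodType) (f : A -> B -> Z) a b : balanced f ->
  tens_lift f (tens a b) = f a b.
Proof. by move=> bf; rewrite tens_lift_class// big_seq1. Qed.

Lemma tens_lift0 (Z : zmodType) (f : A -> B -> Z) : balanced f ->
  tens_lift f 0 = 0.
Proof. by move=> bf; rewrite [0]/(tens_class [::]) tens_lift_class// big_nil. Qed.

End Tensor.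

Definition tens_map (R : nuComRingType) (A B A' B' : nuModType R)
    (f : A -> A') (g : B -> B') : tensor A B -> tensor A' B' :=
  tens_lift (fun a b => tens (f a) (g b)).

Definition tens_flip (R : nuComRingType) (A B : nuModType R) :
    tensor A B -> tensor B A :=
  tens_lift (fun a b => tens b a).

(* The canonical isomorphisms R (x) A = A, A (x) R = A and
   A (x) (B (x) C) = (A (x) B) (x) C *)
Definition tens_unitl (R : nuComRingType) (A : nuModType R) :
    tensor (nu_regular R) A -> A :=
  tens_lift (fun (r : nu_regular R) (a : A) => nuact (r : R) a).

Definition tens_unitr (R : nuComRingType) (A : nuModType R) :
    tensor A (nu_regular R) -> A :=
  tens_lift (fun (a : A) (r : nu_regular R) => nuact (r : R) a).

Definition tens_assoc (R : nuComRingType) (A B C : nuModType R) :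
    tensor A (tensor B C) -> tensor (tensor A B) C :=
  tens_lift (fun a => tens_lift (fun b c => tens (tens a b) c)).

(* [nu_linear f] and [nu_linear g] make [fun a b => tens (f a) (g b)] balanced,
   so [tens_map] is the usual f (x) g in the coalgebra axioms. *)
Record is_coalgebra (R : nuComRingType) (C : nuModType R)
    (Delta : C -> tensor C C) (eps : C -> nu_regular R) : Prop := {
  coalg_base : local_identities R ;
  coalg_unitary : locally_unitary C ;
  coalg_Delta_linear : nu_linear Delta ;
  coalg_eps_linear : nu_linear eps ;
  coalg_counitr : forall c, tens_unitr (tens_map id eps (Delta c)) = c ;
  coalg_counitl : forall c, tens_unitl (tens_map eps id (Delta c)) = c ;
  coalg_coassoc : forall c,
    tens_assoc (tens_map id Delta (Delta c)) = tens_map Delta id (Delta c)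
}.

Definition cocommutative (R : nuComRingType) (C : nuModType R)
    (Delta : C -> tensor C C) :=
  forall c, tens_flip (Delta c) = Delta c.

(* Smoothness on an open subset of a finite-dimensional normed space *)

Section Smooth.
Variables (R : realType) (E F : normedModType R).

(* [iter_derive [:: v1; ...; vk] f] is D_v1 (... (D_vk f)). *)
Definition iter_derive (vs : seq E) (f : E -> F) : E -> F :=
  foldr (fun v g => 'D_v g) f vs.

(* On an open subset of R^n this is C^oo: all iterated directional (in
   particular partial) derivatives exist and are continuous. *)
Definition smooth_on (U : set E) (f : E -> F) := forall vs x, U x ->
  continuous_at x (iter_derive vs f) /\
  forall v, derivable (iter_derive vs f) x v.

Lemma smooth_onS (U V : set E) f : V `<=` U -> smooth_on U f -> smooth_on V f.
Proof. by move=> VU fU vs x /VU; exact: fU. Qed.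

Lemma smooth_on_is_derive U f vs x v : smooth_on U f -> U x ->
  is_derive x v (iter_derive vs f) (iter_derive (v :: vs) f x).
Proof. by move=> fU Ux; apply: DeriveDef => //; apply: (fU vs x Ux).2. Qed.

Lemma iter_derive_ext (U : set E) f g : open U -> {in U, f =1 g} ->
  forall vs, {in U, iter_derive vs f =1 iter_derive vs g}.
Proof.
move=> oU fg; elim=> [|v vs IH] x Ux /=; first exact: fg. apply: near_eq_derive.
have := open_nbhs_nbhs (conj oU (set_mem Ux)); apply: filterS => y Uy.
by apply: IH; rewrite inE.
Qed.

Lemma near_eq_continuous (h k : E -> F) x : (\near x, h x = k x) ->
  continuous_at x h -> continuous_at x k.
Proof.
move=> hk hc; rewrite /continuous_at -(nbhs_singleton hk).
by apply: cvg_trans hc; apply: near_eq_cvg; apply: filterS hk => y ->.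
Qed.

(* If all iterated derivatives agree on U with functions which are continuous
   and derivable there, then the function is smooth. *)
Lemma smooth_on_expand (U : set E) f (D : seq E -> E -> F) : open U ->
  (forall vs, {in U, iter_derive vs f =1 D vs}) ->
  (forall vs x, U x -> continuous_at x (D vs)) ->
  (forall vs x v, U x -> derivable (D vs) x v) -> smooth_on U f.
Proof.
move=> oU fD Dc Dd vs x Ux.
have nfD : \near x, D vs x = iter_derive vs f x.
  have := open_nbhs_nbhs (conj oU Ux); apply: filterS => y Uy.
  by rewrite fD// inE.
split; first exact: near_eq_continuous nfD (Dc vs x Ux).
by move=> v; apply: near_eq_derivable nfD (Dd vs x v Ux).
Qed.

Lemma smooth_on_ext (U : set E) f g : open U -> {in U, f =1 g} ->
  smooth_on U f -> smooth_on U g.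
Proof.
move=> oU fg sf; apply: (@smooth_on_expand _ _ (iter_derive^~ f)) => //.
- by move=> vs x Ux; rewrite (iter_derive_ext oU fg).
- by move=> vs x Ux; case: (sf vs x Ux).
- by move=> vs x v Ux; case: (sf vs x Ux).
Qed.

Lemma iter_derive_lin (U : set E) (a b : R) f g : open U ->
  smooth_on U f -> smooth_on U g -> forall vs,
  {in U, iter_derive vs (fun x => a *: f x + b *: g x) =1
         fun x => a *: iter_derive vs f x + b *: iter_derive vs g x}.
Proof.
move=> oU sf sg; elim=> [|v vs IH] x //; rewrite inE => Ux.
have E1 : \near x, iter_derive vs (fun x => a *: f x + b *: g x) x =
         (a *: iter_derive vs f + b *: iter_derive vs g) x.
  have := open_nbhs_nbhs (conj oU Ux); apply: filterS => y Uy.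
  by rewrite IH ?inE.
rewrite [LHS](near_eq_derive _ E1).
have df := smooth_on_is_derive vs v sf Ux.
have dg := smooth_on_is_derive vs v sg Ux.
have H := @is_deriveD _ _ _ _ _ _ _ _ _ (is_deriveZ a df) (is_deriveZ b dg).
exact: (@derive_val _ _ _ _ _ _ _ H).
Qed.

Lemma smooth_on_lin (U : set E) (a b : R) f g : open U ->
  smooth_on U f -> smooth_on U g -> smooth_on U (fun x => a *: f x + b *: g x).
Proof.
move=> oU sf sg; apply: (smooth_on_expand oU (iter_derive_lin a b oU sf sg)).
- move=> vs x Ux; apply: cvgD; apply: cvgZ; try exact: cvg_cst.
    by case: (sf vs x Ux).
  by case: (sg vs x Ux).
- move=> vs x v Ux; apply: derivableD; apply: derivableZ.
    by case: (sf vs x Ux).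
  by case: (sg vs x Ux).
Qed.

Lemma iter_derive_cst (k : F) vs : iter_derive vs (cst k) =
  cst (if vs is [::] then k else 0).
Proof.
elim: vs => [|v vs IH] //=; rewrite IH; apply/funext => x.
exact: derive_cst.
Qed.

Lemma smooth_on_cst U (k : F) : smooth_on U (cst k).
Proof.
move=> vs x _; rewrite iter_derive_cst; split; first exact: cvg_cst.
by move=> v; exact: derivable_cst.
Qed.

End Smooth.

Section SmoothMul.
Variables (R : realType) (E : normedModType R).

Fixpoint splits (vs : seq E) : seq (seq E * seq E) :=
  if vs is v :: vs' then
    [seq (v :: p.1, p.2) | p <- splits vs'] ++
    [seq (p.1, v :: p.2) | p <- splits vs']
  else [:: ([::], [::])].

Lemma is_derive_big (I : Type) (s : seq I) (h : I -> E -> R) (dh : I -> R) x v :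
  (forall i, is_derive x v (h i) (dh i)) ->
  is_derive x v (fun y => \sum_(i <- s) h i y) (\sum_(i <- s) dh i).
Proof.
move=> hd; elim: s => [|i s IH].
  rewrite big_nil; under eq_fun do rewrite big_nil.
  exact: is_derive_cst.
rewrite big_cons; under eq_fun do rewrite big_cons.
exact: is_deriveD.
Qed.

Lemma continuous_big (T : topologicalType) (I : Type) (s : seq I)
    (h : I -> T -> R) x : (forall i, continuous_at x (h i)) ->
  continuous_at x (fun y => \sum_(i <- s) h i y).
Proof.
move=> hc; elim: s => [|i s IH].
  by under eq_fun do rewrite big_nil; exact: cvg_cst.
under eq_fun do rewrite big_cons.
by apply: cvgD; [exact: hc|exact: IH].
Qed.

Lemma iter_deriveM (U : set E) (f g : E -> R) : open U ->
  smooth_on U f -> smooth_on U g -> forall vs,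
  {in U, iter_derive vs (fun x => f x * g x) =1 fun x =>
         \sum_(p <- splits vs) iter_derive p.1 f x * iter_derive p.2 g x}.
Proof.
move=> oU sf sg; elim=> [|v vs IH] x; first by rewrite /= big_seq1.
rewrite inE => Ux.
have E1 : \near x, iter_derive vs (fun x => f x * g x) x =
    (fun x => \sum_(p <- splits vs) iter_derive p.1 f x * iter_derive p.2 g x) x.
  have := open_nbhs_nbhs (conj oU Ux); apply: filterS => y Uy.
  by rewrite IH ?inE.
rewrite [LHS](near_eq_derive _ E1) /= big_cat !big_map /= -big_split /=.
apply: derive_val; apply: is_derive_big => p.
have df := smooth_on_is_derive p.1 v sf Ux.
have dg := smooth_on_is_derive p.2 v sg Ux.
by apply: is_derive_eq; rewrite addrC; congr (_ + _); exact: mulrC.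
Qed.

Lemma smooth_onM (U : set E) (f g : E -> R) : open U ->
  smooth_on U f -> smooth_on U g -> smooth_on U (fun x => f x * g x).
Proof.
move=> oU sf sg; apply: (smooth_on_expand oU (iter_deriveM oU sf sg)).
- move=> vs x Ux; apply: (@continuous_big _ _ _
    (fun p y => iter_derive p.1 f y * iter_derive p.2 g y)) => p.
  apply: cvgM; first by case: (sf p.1 x Ux).
  by case: (sg p.2 x Ux).
- move=> vs x v Ux; apply: ex_derive; apply: is_derive_big => p.
  have df := smooth_on_is_derive p.1 v sf Ux.
  have dg := smooth_on_is_derive p.2 v sg Ux.
  exact: is_deriveM.
Qed.

Lemma iter_derive_linR (U : set E) (a b : R) (f g : E -> R) : open U ->
  smooth_on U f -> smooth_on U g -> forall vs,
  {in U, iter_derive vs (fun x => a * f x + b * g x) =1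
         fun x => a * iter_derive vs f x + b * iter_derive vs g x}.
Proof. exact: (@iter_derive_lin R E R U a b f g). Qed.

Lemma smooth_on_linR (U : set E) (a b : R) (f g : E -> R) : open U ->
  smooth_on U f -> smooth_on U g -> smooth_on U (fun x => a * f x + b * g x).
Proof. exact: (@smooth_on_lin R E R U a b f g). Qed.

End SmoothMul.

Section SmoothProd.
Variables (R : realType) (E E' F F' : normedModType R).

Lemma iter_derive_fst (f : E -> F) vs :
  iter_derive vs (f \o (fst : E * E' -> E)) = iter_derive (map fst vs) f \o fst.
Proof. by elim: vs => //= v vs ->; apply/funext => x. Qed.

Lemma iter_derive_snd (f : E' -> F) vs :
  iter_derive vs (f \o (snd : E * E' -> E')) = iter_derive (map snd vs) f \o snd.
Proof. by elim: vs => //= v vs ->; apply/funext => x. Qed.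

Lemma smooth_on_fst (U : set E) (f : E -> F) :
  smooth_on U f -> smooth_on (fst @^-1` U) (f \o (fst : E * E' -> E)).
Proof.
move=> sf vs x Ux; rewrite iter_derive_fst.
have [fc fd] := sf (map fst vs) _ Ux; split.
  by apply: (@continuous_comp _ _ _ fst) => //; exact: cvg_fst.
by move=> v; exact: (fd v.1).
Qed.

Lemma smooth_on_snd (U : set E') (f : E' -> F) :
  smooth_on U f -> smooth_on (snd @^-1` U) (f \o (snd : E * E' -> E')).
Proof.
move=> sf vs x Ux; rewrite iter_derive_snd.
have [fc fd] := sf (map snd vs) _ Ux; split.
  by apply: (@continuous_comp _ _ _ snd) => //; exact: cvg_snd.
by move=> v; exact: (fd v.2).
Qed.

Lemma derive_slice (h : E * E' -> F) q (v x : E) :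
  (fun t : R => t^-1 *: (((fun x => h (x, q)) \o shift x) (t *: v) - h (x, q))) =
  (fun t : R => t^-1 *: ((h \o shift (x, q)) (t *: (v, 0)) - h (x, q))).
Proof.
apply/funext => t; congr (_ *: (h _ - _)).
by rewrite /shift; congr pair; rewrite /= scaler0 add0r.
Qed.

Lemma iter_derive_slice (h : E * E' -> F) q vs x :
  iter_derive vs (fun x => h (x, q)) x =
  iter_derive [seq (v, 0) | v <- vs] h (x, q).
Proof.
elim: vs x => //= v vs IH x.
have -> : iter_derive vs (fun x => h (x, q)) =
  fun x => iter_derive [seq (v, 0) | v <- vs] h (x, q).
  by apply/funext => y; exact: IH.
by rewrite /derive derive_slice.
Qed.

Lemma smooth_on_slice (U : set (E * E')) (h : E * E' -> F) q :
  smooth_on U h -> smooth_on [set x | U (x, q)] (fun x => h (x, q)).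
Proof.
move=> sh vs x Ux.
have -> : iter_derive vs (fun x => h (x, q)) =
  fun x => iter_derive [seq (v, 0) | v <- vs] h (x, q).
  by apply/funext => y; exact: iter_derive_slice.
have [hc hd] := sh [seq (v, 0) | v <- vs] _ Ux; split.
  apply: (@continuous_comp _ _ _ (fun x => (x, q))) => //.
  by apply: cvg_pair; [exact: cvg_id|exact: cvg_cst].
by move=> v; rewrite /derivable derive_slice; exact: hd.
Qed.

Lemma is_derive_pair (f : E -> F) (g : E -> F') x v df dg :
  is_derive x v f df -> is_derive x v g dg ->
  is_derive x v (fun x => (f x, g x)) (df, dg).
Proof.
move=> [fd <-] [gd <-].
have : (fun h : R => h^-1 *: (((fun x => (f x, g x)) \o shift x) (h *: v)
    - (f x, g x))) @ 0^' --> ('D_v f x, 'D_v g x).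
  by apply: cvg_pair; [exact: fd|exact: gd].
by move=> H; apply: DeriveDef; [exact: cvgP H|exact: cvg_lim H].
Qed.

Lemma iter_derive_pair (U : set E) (f : E -> F) (g : E -> F') : open U ->
  smooth_on U f -> smooth_on U g -> forall vs,
  {in U, iter_derive vs (fun x => (f x, g x)) =1
         fun x => (iter_derive vs f x, iter_derive vs g x)}.
Proof.
move=> oU sf sg; elim=> [|v vs IH] x //; rewrite inE => Ux.
have E1 : \near x, iter_derive vs (fun x => (f x, g x)) x =
    (fun x => (iter_derive vs f x, iter_derive vs g x)) x.
  have := open_nbhs_nbhs (conj oU Ux); apply: filterS => y Uy.
  by rewrite IH ?inE.
rewrite [LHS](near_eq_derive _ E1).
apply: derive_val; apply: is_derive_pair; exact: smooth_on_is_derive Ux.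
Qed.

Lemma smooth_on_pair (U : set E) (f : E -> F) (g : E -> F') : open U ->
  smooth_on U f -> smooth_on U g -> smooth_on U (fun x => (f x, g x)).
Proof.
move=> oU sf sg; apply: (smooth_on_expand oU (iter_derive_pair oU sf sg)).
- move=> vs x Ux; apply: cvg_pair; first by case: (sf vs x Ux).
  by case: (sg vs x Ux).
- move=> vs x v Ux; apply: ex_derive; apply: is_derive_pair;
    exact: smooth_on_is_derive Ux.
Qed.

End SmoothProd.

(* C-valued functions *)

Section SmoothC.
Variables (R : realType) (E : normedModType R).
Implicit Types (U : set E) (f g : E -> R[i]).

Definition smoothC_on U f :=
  smooth_on U (@complex.Re R \o f) /\ smooth_on U (@complex.Im R \o f).

Definition iter_deriveC (vs : seq E) f (x : E) : R[i] :=
  (iter_derive vs (@complex.Re R \o f) x +i*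
   iter_derive vs (@complex.Im R \o f) x)%C.

Lemma smoothC_onS U V f : V `<=` U -> smoothC_on U f -> smoothC_on V f.
Proof. by move=> VU [? ?]; split; apply: smooth_onS VU _. Qed.

Lemma smoothC_on_ext U f g : open U -> {in U, f =1 g} ->
  smoothC_on U f -> smoothC_on U g.
Proof.
move=> oU fg [s1 s2].
by split; [apply: smooth_on_ext s1|apply: smooth_on_ext s2] => //;
   move=> x Ux /=; rewrite fg.
Qed.

Lemma iter_deriveC_ext U f g : open U -> {in U, f =1 g} ->
  forall vs, {in U, iter_deriveC vs f =1 iter_deriveC vs g}.
Proof.
move=> oU fg vs x Ux; congr (_ +i* _)%C; apply: (iter_derive_ext oU) Ux;
  by move=> y Uy /=; rewrite fg.
Qed.

Lemma smoothC_on_cst U (k : R[i]) : smoothC_on U (cst k).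
Proof. by split; exact: smooth_on_cst. Qed.

Let ReD f g : @complex.Re R \o (fun x => f x + g x) =
  fun x => 1 * (@complex.Re R \o f) x + 1 * (@complex.Re R \o g) x.
Proof. by apply/funext => x /=; rewrite !mul1r; case: (f x) (g x) => ? ? []. Qed.
Let ImD f g : @complex.Im R \o (fun x => f x + g x) =
  fun x => 1 * (@complex.Im R \o f) x + 1 * (@complex.Im R \o g) x.
Proof. by apply/funext => x /=; rewrite !mul1r; case: (f x) (g x) => ? ? []. Qed.
Let ReM f g : @complex.Re R \o (fun x => f x * g x) = fun x =>
  1 * ((@complex.Re R \o f) x * (@complex.Re R \o g) x) +
  (-1) * ((@complex.Im R \o f) x * (@complex.Im R \o g) x).
Proof.
by apply/funext => x /=; rewrite mul1r mulN1r; case: (f x) (g x) => ? ? [].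
Qed.
Let ImM f g : @complex.Im R \o (fun x => f x * g x) = fun x =>
  1 * ((@complex.Re R \o f) x * (@complex.Im R \o g) x) +
  1 * ((@complex.Im R \o f) x * (@complex.Re R \o g) x).
Proof. by apply/funext => x /=; rewrite !mul1r; case: (f x) (g x) => ? ? []. Qed.

Lemma smoothC_onD U f g : open U -> smoothC_on U f -> smoothC_on U g ->
  smoothC_on U (fun x => f x + g x).
Proof.
move=> oU [f1 f2] [g1 g2]; split; [rewrite ReD|rewrite ImD].
  exact: (smooth_on_linR 1 1 oU f1 g1).
exact: (smooth_on_linR 1 1 oU f2 g2).
Qed.

Lemma iter_deriveCD U f g : open U -> smoothC_on U f -> smoothC_on U g ->
  forall vs, {in U, iter_deriveC vs (fun x => f x + g x) =1
    fun x => iter_deriveC vs f x + iter_deriveC vs g x}.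
Proof.
move=> oU [f1 f2] [g1 g2] vs x Ux; rewrite /iter_deriveC ReD ImD.
rewrite (iter_derive_linR 1 1 oU f1 g1 vs Ux).
by rewrite (iter_derive_linR 1 1 oU f2 g2 vs Ux) !mul1r.
Qed.

Lemma smoothC_onM U f g : open U -> smoothC_on U f -> smoothC_on U g ->
  smoothC_on U (fun x => f x * g x).
Proof.
move=> oU [f1 f2] [g1 g2]; split; [rewrite ReM|rewrite ImM].
  exact: (smooth_on_linR 1 (-1) oU (smooth_onM oU f1 g1) (smooth_onM oU f2 g2)).
exact: (smooth_on_linR 1 1 oU (smooth_onM oU f1 g2) (smooth_onM oU f2 g1)).
Qed.

Lemma iter_deriveCM U f g : open U -> smoothC_on U f -> smoothC_on U g ->
  forall vs, {in U, iter_deriveC vs (fun x => f x * g x) =1 fun x =>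
    \sum_(p <- splits vs) iter_deriveC p.1 f x * iter_deriveC p.2 g x}.
Proof.
move=> oU [f1 f2] [g1 g2] vs x Ux; rewrite /iter_deriveC ReM ImM.
rewrite (iter_derive_linR 1 (-1) oU (smooth_onM oU f1 g1) (smooth_onM oU f2 g2)
  vs Ux).
rewrite (iter_derive_linR 1 1 oU (smooth_onM oU f1 g2) (smooth_onM oU f2 g1)
  vs Ux).
rewrite !(iter_deriveM oU f1 g1 vs Ux) !(iter_deriveM oU f2 g2 vs Ux).
rewrite !(iter_deriveM oU f1 g2 vs Ux) !(iter_deriveM oU f2 g1 vs Ux).
rewrite !mul1r mulN1r.
elim: (splits vs) => [|p s IH]; first by rewrite !big_nil subr0 addr0.
rewrite !big_cons -IH; congr (_ +i* _)%C; last by rewrite addrACA.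
by rewrite opprD addrACA.
Qed.

Lemma iter_deriveCZ U (k : R[i]) f : open U -> smoothC_on U f ->
  forall vs, {in U, iter_deriveC vs (fun x => k * f x) =1
    fun x => k * iter_deriveC vs f x}.
Proof.
move=> oU [f1 f2] vs x Ux; rewrite /iter_deriveC.
have -> : @complex.Re R \o (fun x => k * f x) = fun x => complex.Re k *
    (@complex.Re R \o f) x + (- complex.Im k) * (@complex.Im R \o f) x.
  by apply/funext => y; rewrite mulNr /=; case: k (f y) => ? ? [].
have -> : @complex.Im R \o (fun x => k * f x) = fun x =>
    complex.Re k * (@complex.Im R \o f) x + complex.Im k * (@complex.Re R \o f) x.
  by apply/funext => y /=; case: k (f y) => ? ? [].
rewrite (iter_derive_linR _ _ oU f1 f2 vs Ux).
rewrite (iter_derive_linR _ _ oU f2 f1 vs Ux) mulNr.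
by case: k.
Qed.

End SmoothC.

(* Manifolds modelled on a finite-dimensional space E.  The factors are
   modelled on 'rV[R]_n, their product on 'rV[R]_m * 'rV[R]_n. *)

Section Manifold.
Variables (R : realType) (E : normedModType R) (M : topologicalType).

Record chart := Chart {
  chart_dom : set M ;
  chart_cod : set E ;
  chart_fun :> M -> E ;
  chart_inv : E -> M ;
  chart_dom_open : open chart_dom ;
  chart_cod_open : open chart_cod ;
  chart_funP : forall x, chart_dom x -> chart_cod (chart_fun x) ;
  chart_invP : forall p, chart_cod p -> chart_dom (chart_inv p) ;
  chart_funK : forall x, chart_dom x -> chart_inv (chart_fun x) = x ;
  chart_invK : forall p, chart_cod p -> chart_fun (chart_inv p) = p ;
  chart_fun_continuous : forall x, chart_dom x -> continuous_at x chart_fun ;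
  chart_inv_continuous : forall p, chart_cod p -> continuous_at p chart_inv
}.

Definition overlap (c d : chart) : set E :=
  [set p | chart_cod c p /\ chart_dom d (chart_inv c p)].

Record smooth_structure := SmoothStructure {
  atlas : set chart ;
  atlas_cover : forall x, exists2 c, atlas c & chart_dom c x ;
  atlas_compat : forall c d, atlas c -> atlas d ->
    smooth_on (overlap c d) (d \o chart_inv c)
}.

Lemma overlap_open c d : open (overlap c d).
Proof.
rewrite openE => p [cp dp]; rewrite /interior.
have := open_nbhs_nbhs (conj (chart_cod_open c) cp).
have : nbhs p (chart_inv c @^-1` chart_dom d).
  apply: (chart_inv_continuous cp).
  exact: open_nbhs_nbhs (conj (chart_dom_open d) dp).
by apply: filterS2 => q.
Qed.

End Manifold.

Lemma open_setX (S T : topologicalType) (X : set S) (Y : set T) :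
  open X -> open Y -> open (X `*` Y).
Proof.
move=> oX oY; rewrite openE => -[x y] [/= Xx Yy]; exists (X, Y) => //.
by split; exact: open_nbhs_nbhs.
Qed.

Lemma continuous_prod_map (S S' T T' : topologicalType) (f : S -> T)
    (g : S' -> T') x y : continuous_at x f -> continuous_at y g ->
  continuous_at (x, y) (fun z => (f z.1, g z.2)).
Proof.
move=> fc gc U [[P Q] [/= nP nQ] PQ]; exists (f @^-1` P, g @^-1` Q) => /=.
  by split; [exact: fc|exact: gc].
by move=> [a b] [/= Pa Qb]; exact: (PQ (f a, g b)).
Qed.

Section ProductManifold.
Variables (R : realType) (E E' : normedModType R) (M N : topologicalType).

Section ProductChart.
Variables (c : chart E M) (d : chart E' N).

Program Definition prod_chart : chart (E * E')%type (M * N)%type := {|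
  chart_dom := chart_dom c `*` chart_dom d ;
  chart_cod := chart_cod c `*` chart_cod d ;
  chart_fun := fun z => (c z.1, d z.2) ;
  chart_inv := fun p => (chart_inv c p.1, chart_inv d p.2)
|}.
Next Obligation. by apply: open_setX; exact: chart_dom_open. Qed.
Next Obligation. by apply: open_setX; exact: chart_cod_open. Qed.
Next Obligation. by move=> [x y] [/= cx dy]; split; exact: chart_funP. Qed.
Next Obligation. by move=> [x y] [/= cx dy]; split; exact: chart_invP. Qed.
Next Obligation. by move=> [x y] [/= cx dy]; rewrite !chart_funK. Qed.
Next Obligation. by move=> [x y] [/= cx dy]; rewrite !chart_invK. Qed.
Next Obligation.
move=> [x y] [/= cx dy]; apply: continuous_prod_map;
  exact: chart_fun_continuous.
Qed.
Next Obligation.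
move=> [x y] [/= cx dy]; apply: continuous_prod_map;
  exact: chart_inv_continuous.
Qed.

End ProductChart.

Variables (A : smooth_structure E M) (B : smooth_structure E' N).

Program Definition prod_smooth : smooth_structure (E * E')%type (M * N)%type := {|
  atlas := [set prod_chart c d | c in atlas A & d in atlas B]
|}.
Next Obligation.
move=> [x y]; have [c Ac cx] := atlas_cover A x.
have [d Bd dy] := atlas_cover B y.
by exists (prod_chart c d) => //; exists c => //; exists d.
Qed.
Next Obligation.
move=> _ _ [c Ac [d Bd <-]] [c' Ac' [d' Bd' <-]].
apply: (@smooth_on_pair _ _ _ _ _ (c' \o chart_inv c \o fst)
  (d' \o chart_inv d \o snd)).
- exact: overlap_open.
- apply: smooth_onS (smooth_on_fst (atlas_compat Ac Ac')) => -[p q].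
  by move=> [[/= ? ?] [/= ? ?]].
- apply: smooth_onS (smooth_on_snd (atlas_compat Bd Bd')) => -[p q].
  by move=> [[/= ? ?] [/= ? ?]].
Qed.

End ProductManifold.

(* Translation-invariant topologies on abelian groups *)

Section ShiftTopology.
Variables (V : zmodType) (N0 : set_system V).

Definition shift_nbhs (x : V) : set_system V := [set U | N0 [set h | U (x + h)]].

Hypothesis N0F : Filter N0.
Hypothesis N0_0 : forall U, N0 U -> U 0.
Hypothesis N0_half : forall U, N0 U ->
  exists2 W, N0 W & forall a b, W a -> W b -> U (a + b).

Lemma shift_nbhs_pfilter x : ProperFilter (shift_nbhs x).
Proof.
split; first by move=> /N0_0.
split; first exact: filterT.
- by move=> U U' HU HU'; apply: filterI.
- by move=> U U' UU' HU; apply: filterS HU => h; exact: UU'.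
Qed.

Lemma shift_nbhs_singleton x U : shift_nbhs x U -> U x.
Proof. by move=> /N0_0 /=; rewrite addr0. Qed.

Lemma shift_nbhs_nbhs x U : shift_nbhs x U -> shift_nbhs x (shift_nbhs^~ U).
Proof.
move=> /N0_half [W NW WU]; apply: (@filterS _ N0 _ W) (NW) => h Wh.
by apply: (@filterS _ N0 _ W) NW => k Wk /=; rewrite -addrA; exact: WU.
Qed.

End ShiftTopology.

Definition absconvex (R : realType) (V : lmodType R[i]) (W : set V) :=
  forall (s t : R[i]) v w, `|s| + `|t| <= 1 -> W v -> W w -> W (s *: v + t *: w).

Definition vN_bounded (R : realType) (V : preTopologicalLmodType R[i])
    (A : set V) :=
  forall U, nbhs (0 : V) U -> exists2 r : R[i], 0 < r &
    forall c : R[i], r <= `|c| -> A `<=` [set c *: u | u in U].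

(* C^oo(M) *)

Section Cinf.
Variables (R : realType) (E : normedModType R) (M : topologicalType).
Variable A : smooth_structure E M.

Definition smooth_pred : {pred M -> R[i]} := fun f =>
  `[< forall c, atlas A c -> smoothC_on (chart_cod c) (f \o chart_inv c) >].

Lemma smooth_predP f : reflect
  (forall c, atlas A c -> smoothC_on (chart_cod c) (f \o chart_inv c))
  (f \in smooth_pred).
Proof. exact: asboolP. Qed.

Lemma smooth_predM f g : f \in smooth_pred -> g \in smooth_pred ->
  (fun x => f x * g x) \in smooth_pred.
Proof.
move=> /smooth_predP sf /smooth_predP sg; apply/smooth_predP => c Ac.
by apply: smoothC_onM; [exact: chart_cod_open|exact: sf|exact: sg].
Qed.

Lemma smooth_pred_cst k : cst k \in smooth_pred.
Proof. by apply/smooth_predP => c Ac; exact: smoothC_on_cst. Qed.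

Fact smooth_pred_submod : submod_closed smooth_pred.
Proof.
split; first exact: smooth_pred_cst.
move=> k f g sf sg.
have /smooth_predP skf := smooth_predM (smooth_pred_cst k) sf.
move/smooth_predP: sg => sg; apply/smooth_predP => c Ac.
by apply: smoothC_onD; [exact: chart_cod_open|exact: skf|exact: sg].
Qed.
HB.instance Definition _ :=
  GRing.isSubmodClosed.Build R[i] (M -> R[i]) smooth_pred smooth_pred_submod.

Record Cinf := MkCinf { Cinf_val :> M -> R[i] ; _ : Cinf_val \in smooth_pred }.

HB.instance Definition _ := [isSub for Cinf_val].
HB.instance Definition _ := [Choice of Cinf by <:].
HB.instance Definition _ := [SubChoice_isSubLmodule of Cinf by <:].

Lemma Cinf_smooth (F : Cinf) : (F : M -> R[i]) \in smooth_pred.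
Proof. by case: F. Qed.

Lemma CinfP (F G : Cinf) : (forall x, F x = G x) -> F = G.
Proof. by move=> FG; apply/val_inj/funext. Qed.

(* A jet test consists of a chart c, a compact subset K of its domain and a
   list vs of directions; it measures the sup over K of |D_vs (F o c^-1)|. *)
Record jet_test := JetTest {
  jet_chart : chart E M ;
  jet_set : set M ;
  jet_dirs : seq E ;
  jet_atlas : atlas A jet_chart ;
  jet_compact : compact jet_set ;
  jet_sub : jet_set `<=` chart_dom jet_chart
}.

(* In R[i], [0 < e] says that e is a positive real number. *)
Definition jet_lt (e : R[i]) (t : jet_test) (F : M -> R[i]) :=
  forall x, jet_set t x ->
    `|iter_deriveC (jet_dirs t) (F \o chart_inv (jet_chart t))
        (jet_chart t x)| < e.

Definition Cinf_nbhs0 : set_system Cinf := [set U |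
  exists (s : seq jet_test) (e : R[i]), 0 < e /\
    [set F : Cinf | forall t, List.In t s -> jet_lt e t F] `<=` U].

Lemma jet_iter_deriveC (F : Cinf) c : atlas A c ->
  smoothC_on (chart_cod c) ((F : M -> R[i]) \o chart_inv c).
Proof. by move/smooth_predP: (Cinf_smooth F); exact. Qed.

Lemma jet_ltD e e' t (F G : Cinf) :
  jet_lt e t F -> jet_lt e' t G -> jet_lt (e + e') t (F + G : Cinf).
Proof.
move=> HF HG x tx; have Ac := jet_atlas t.
have cx : jet_chart t x \in chart_cod (jet_chart t).
  by rewrite inE; apply: chart_funP; exact: jet_sub tx.
have -> := iter_deriveCD (chart_cod_open (jet_chart t))
  (jet_iter_deriveC F Ac) (jet_iter_deriveC G Ac) (jet_dirs t) cx.
by apply: le_lt_trans (ler_normD _ _) _; apply: ltrD; [exact: HF|exact: HG].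
Qed.

Lemma jet_ltZ e t k (F : Cinf) : k != 0 ->
  jet_lt e t F -> jet_lt (`|k| * e) t (k *: F : Cinf).
Proof.
move=> k0 HF x tx; have Ac := jet_atlas t.
have cx : jet_chart t x \in chart_cod (jet_chart t).
  by rewrite inE; apply: chart_funP; exact: jet_sub tx.
have -> := iter_deriveCZ k (chart_cod_open (jet_chart t))
  (jet_iter_deriveC F Ac) (jet_dirs t) cx.
by rewrite normrM ltr_pM2l ?normr_gt0//; exact: HF.
Qed.

Lemma jet_lt0 e t : 0 < e -> jet_lt e t (0 : Cinf).
Proof.
move=> e0 x tx.
have -> : (0 : Cinf) \o chart_inv (jet_chart t) = cst 0 by [].
rewrite /iter_deriveC.
have -> : @complex.Re R \o cst 0 = (cst 0 : E -> R) by [].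
have -> : @complex.Im R \o cst 0 = (cst 0 : E -> R) by [].
by rewrite iter_derive_cst; case: jet_dirs => [|? ?]; rewrite normr0.
Qed.

Lemma jet_lt_nbhs0 e t : 0 < e -> Cinf_nbhs0 [set F | jet_lt e t F].
Proof. by move=> e0; exists [:: t], e; split => // F; apply; left. Qed.

Lemma min_gt0 (a b : R[i]) : 0 < a -> 0 < b ->
  exists2 e, 0 < e & e <= a /\ e <= b.
Proof.
move=> a0 b0; have r : a >=< b by apply: real_comparable; exact: gtr0_real.
exists (Order.min a b); first by rewrite comparable_lt_min// a0.
by split; rewrite comparable_ge_min// lexx ?orbT.
Qed.

Lemma jet_ltW e e' t (F : Cinf) : e <= e' -> jet_lt e t F -> jet_lt e' t F.
Proof. by move=> ee' HF x tx; apply: lt_le_trans ee'; exact: HF. Qed.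

Fact Cinf_nbhs0_filter : Filter Cinf_nbhs0.
Proof.
split; first by exists [::], 1.
- move=> U V [s [e [e0 sU]]] [s' [e' [e'0 s'V]]].
  have [d d0 [de de']] := min_gt0 e0 e'0.
  exists (s ++ s'), d; split => // F HF; split.
  + apply: sU => t ts; apply: jet_ltW de _; apply: HF.
    by apply: List.in_or_app; left.
  + apply: s'V => t ts; apply: jet_ltW de' _; apply: HF.
    by apply: List.in_or_app; right.
- move=> U V UV [s [e [e0 sU]]]; exists s, e; split => //.
  exact: subset_trans sU UV.
Qed.

Fact Cinf_nbhs0_0 U : Cinf_nbhs0 U -> U 0.
Proof. by move=> [s [e [e0 sU]]]; apply: sU => t _; exact: jet_lt0. Qed.

Fact Cinf_nbhs0_half U : Cinf_nbhs0 U ->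
  exists2 W, Cinf_nbhs0 W & forall a b, W a -> W b -> U (a + b).
Proof.
move=> [s [e [e0 sU]]].
exists [set F : Cinf | forall t, List.In t s -> jet_lt (e / 2) t F].
  by exists s, (e / 2); split => //; rewrite divr_gt0.
move=> F G HF HG; apply: sU => t ts; rewrite (splitr e).
by apply: jet_ltD; [exact: HF|exact: HG].
Qed.

HB.instance Definition _ := hasNbhs.Build Cinf (shift_nbhs Cinf_nbhs0).
HB.instance Definition _ := Nbhs_isNbhsTopological.Build Cinf
  (shift_nbhs_pfilter Cinf_nbhs0_filter Cinf_nbhs0_0)
  (shift_nbhs_singleton Cinf_nbhs0_0)
  (shift_nbhs_nbhs Cinf_nbhs0_filter Cinf_nbhs0_half).

Lemma Cinf_nbhs0E : nbhs (0 : Cinf) = Cinf_nbhs0.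
Proof.
apply/seteqP; split => U.
  by rewrite {1}/nbhs /= /shift_nbhs /=; under [X in Cinf_nbhs0 X]eq_set do rewrite add0r.
by move=> HU; rewrite /nbhs /= /shift_nbhs /=; under eq_set do rewrite add0r.
Qed.

Lemma Cinf_nbhs0Z k U : k != 0 -> Cinf_nbhs0 U ->
  Cinf_nbhs0 [set F | U (k *: F)].
Proof.
move=> k0 [s [e [e0 sU]]]; exists s, (e / `|k|).
have nk0 : 0 < `|k| by rewrite normr_gt0.
split; first by rewrite divr_gt0.
move=> F HF; apply: sU => t ts; rewrite -(divfK (lt0r_neq0 nk0) e) mulrC.
by apply: jet_ltZ => //; exact: HF.
Qed.

Lemma normC_le (a b : R) : `|(a +i* b)%C| <= (`|a| + `|b|)%:C%C :> R[i].
Proof.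
rewrite normc_def lecR /=.
rewrite -[leRHS]ger0_norm ?addr_ge0// -sqrtr_sqr ler_wsqrtr//.
by rewrite sqrrD !real_normK ?num_real// lerD2r lerDl mulrn_wge0// mulr_ge0.
Qed.

Lemma jet_bounded (f : M -> R[i]) c (K : set M) vs : f \in smooth_pred ->
  atlas A c -> compact K -> K `<=` chart_dom c ->
  exists2 b : R[i], 0 < b &
    forall x, K x -> `|iter_deriveC vs (f \o chart_inv c) (c x)| <= b.
Proof.
move=> /smooth_predP sf Ac cK Kc; have [s1 s2] := sf c Ac.
have bnd (g : E -> R) : smooth_on (chart_cod c) g ->
    exists2 b : R, 0 <= b & forall x, K x -> `|iter_derive vs g (c x)| <= b.
  move=> sg; set h := fun x => iter_derive vs g (c x).
  have ch : compact (h @` K).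
    apply: continuous_compact => //; apply: continuous_in_subspaceT => x.
    rewrite inE => Kx; have cx := Kc x Kx.
    have hc := (sg vs _ (chart_funP cx)).1.
    exact: (continuous_comp (chart_fun_continuous cx) hc).
  have [b [_ hb]] := compact_bounded ch.
  exists (`|b| + 1); first by rewrite addr_ge0.
  move=> x Kx; apply: (hb (`|b| + 1)); last by exists x.
  by apply: le_lt_trans (ler_norm b) _; rewrite ltrDl.
have [b1 b1_ge0 H1] := bnd _ s1; have [b2 b2_ge0 H2] := bnd _ s2.
exists (b1 + b2 + 1)%:C%C; first by rewrite ltcR ltr_wpDl// addr_ge0.
move=> x Kx; apply: le_trans (normC_le _ _) _; rewrite lecR.
by rewrite ler_wpDr// lerD//; [exact: H1|exact: H2].
Qed.

(* C^oo_c(M) *)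

Definition tsupport (f : M -> R[i]) : set M := closure [set x | f x != 0].

Definition smooth_compact_pred : {pred M -> R[i]} := fun f =>
  (f \in smooth_pred) && `[< compact (tsupport f) >].

Lemma tsupport_sub_compact f (K : set M) :
  compact K -> tsupport f `<=` K -> compact (tsupport f).
Proof.
move=> cK fK; rewrite -(setIidr fK).
by apply: compact_closedI => //; exact: closed_closure.
Qed.

Lemma tsupportM f g : tsupport (fun x => f x * g x) `<=` tsupport f.
Proof. by apply: closure_subset => x /=; rewrite mulf_eq0 negb_or => /andP[]. Qed.

Lemma tsupportD f g : tsupport (fun x => f x + g x) `<=` tsupport f `|` tsupport g.
Proof.
rewrite /tsupport -closureU; apply: closure_subset => x /= fg0.
have [f0|f0] := eqVneq (f x) 0; last by left.
by right; move: fg0; rewrite f0 add0r.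
Qed.

Fact smooth_compact_submod : submod_closed smooth_compact_pred.
Proof.
split.
  apply/andP; split; first exact: rpred0.
  apply/asboolP; apply: (@tsupport_sub_compact _ set0) => //; first exact: compact0.
  rewrite /tsupport; have -> : [set x : M | (0 : M -> R[i]) x != 0] = set0.
    by apply/seteqP; split => // x /=; rewrite eqxx.
  by rewrite closure0.
move=> k f g /andP[sf /asboolP cf] /andP[sg /asboolP cg]; apply/andP; split.
  exact: (smooth_pred_submod.2 k f g sf sg).
apply/asboolP; apply: (@tsupport_sub_compact _ (tsupport f `|` tsupport g)).
  exact: compactU.
apply: subset_trans (@tsupportD (fun x => k * f x) g) _; apply: setSU.
by have := @tsupportM f (cst k); under [X in tsupport X]eq_fun do rewrite mulrC.
Qed.
HB.instance Definition _ := GRing.isSubmodClosed.Build R[i] (M -> R[i])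
  smooth_compact_pred smooth_compact_submod.

Record Cc := MkCc {
  Cc_val :> M -> R[i] ;
  _ : Cc_val \in smooth_compact_pred
}.

HB.instance Definition _ := [isSub for Cc_val].
HB.instance Definition _ := [Choice of Cc by <:].
HB.instance Definition _ := [SubChoice_isSubLmodule of Cc by <:].

Lemma Cc_smooth (f : Cc) : (f : M -> R[i]) \in smooth_pred.
Proof. by case: f => f fP /=; have /andP[] := fP. Qed.

Lemma Cc_compact (f : Cc) : compact (tsupport f).
Proof. by case: f => f fP /=; have /andP[_ /asboolP] := fP. Qed.

Lemma CcP (f g : Cc) : (forall x, f x = g x) -> f = g.
Proof. by move=> fg; apply/val_inj/funext. Qed.

Fact Cc_mul_subproof (f g : Cc) :
  (fun x => f x * g x) \in smooth_compact_pred.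
Proof.
apply/andP; split; first by apply: smooth_predM; exact: Cc_smooth.
apply/asboolP; apply: (@tsupport_sub_compact _ (tsupport f)).
  exact: Cc_compact.
exact: tsupportM.
Qed.
Definition Cc_mul (f g : Cc) : Cc := MkCc (Cc_mul_subproof f g).

Fact Cc_mulA : associative Cc_mul.
Proof. by move=> f g h; apply: CcP => x /=; rewrite mulrA. Qed.
Fact Cc_mulC : commutative Cc_mul.
Proof. by move=> f g; apply: CcP => x /=; rewrite mulrC. Qed.
Fact Cc_mulDl : left_distributive Cc_mul +%R.
Proof. by move=> f g h; apply: CcP => x /=; rewrite -mulrDl. Qed.
HB.instance Definition _ :=
  Zmodule_isNuComRing.Build Cc Cc_mulA Cc_mulC Cc_mulDl.

Definition Cc_incl (f : Cc) : Cinf := MkCinf (Cc_smooth f).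

Lemma Cc_inclD f g : Cc_incl (f + g) = Cc_incl f + Cc_incl g.
Proof. exact: CinfP. Qed.
Lemma Cc_inclZ k f : Cc_incl (k *: f) = k *: Cc_incl f.
Proof. exact: CinfP. Qed.

(* The locally convex inductive limit topology: an absolutely convex W is a
   neighbourhood of zero iff its trace on each C^oo_c(L) is one. *)
Definition Cc_nbhs0 : set_system Cc := [set U | exists W : set Cc,
  [/\ absconvex W, W `<=` U &
      forall L : set M, compact L -> exists2 P : set Cinf, nbhs (0 : Cinf) P &
        forall f : Cc, tsupport f `<=` L -> P (Cc_incl f) -> W f]].

Fact Cc_nbhs0_filter : Filter Cc_nbhs0.
Proof.
split.
- by exists setT; split => // L _; exists setT => //; exact: filterT.
- move=> U V [W [aW WU HW]] [W' [aW' WV HW']]; exists (W `&` W'); split.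
  + by move=> s t v w st [Wv W'v] [Ww W'w]; split; [exact: aW|exact: aW'].
  + exact: setISS.
  + move=> L cL; have [P nP HP] := HW L cL; have [P' nP' HP'] := HW' L cL.
    exists (P `&` P'); first exact: filterI.
    by move=> f fL [Pf P'f]; split; [exact: HP|exact: HP'].
- move=> U V UV [W [aW WU HW]]; exists W; split => //.
  exact: subset_trans WU UV.
Qed.

Fact Cc_nbhs0_0 U : Cc_nbhs0 U -> U 0.
Proof.
move=> [W [aW WU HW]]; apply: WU.
have [P nP HP] := HW set0 (@compact0 _); apply: HP; last first.
  rewrite (_ : Cc_incl 0 = 0); last exact: CinfP.
  exact: nbhs_singleton nP.
rewrite /tsupport; have -> : [set x : M | (0 : Cc) x != 0] = set0.
  by apply/seteqP; split => // x /=; rewrite eqxx.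
by rewrite closure0.
Qed.

Fact Cc_nbhs0_half U : Cc_nbhs0 U ->
  exists2 W, Cc_nbhs0 W & forall a b, W a -> W b -> U (a + b).
Proof.
move=> [W [aW WU HW]]; have n20 : (2 : R[i]) != 0 by rewrite pnatr_eq0.
exists [set f | W (2 *: f)]; last first.
  move=> f g Wf Wg; apply: WU.
  rewrite (_ : f + g = 2^-1 *: (2 *: f) + 2^-1 *: (2 *: g)); last first.
    by rewrite !scalerA mulVf// !scale1r.
  by apply: aW => //; rewrite ger0_norm ?invr_ge0// [leRHS](splitr 1) !div1r.
exists [set f | W (2 *: f)]; split => //.
  move=> s t v w st Wv Ww /=.
  by rewrite scalerDr !scalerA !(mulrC 2) -!scalerA; exact: aW.
move=> L cL; have [P nP HP] := HW L cL.
exists [set F | P (2 *: F)].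
  by move: nP; rewrite Cinf_nbhs0E => nP; exact: Cinf_nbhs0Z.
move=> f fL PF; apply: HP; last by rewrite Cc_inclZ.
apply: subset_trans fL; have := @tsupportM f (cst 2).
by under [X in tsupport X]eq_fun do rewrite mulrC.
Qed.

HB.instance Definition _ := hasNbhs.Build Cc (shift_nbhs Cc_nbhs0).
HB.instance Definition _ := Nbhs_isNbhsTopological.Build Cc
  (shift_nbhs_pfilter Cc_nbhs0_filter Cc_nbhs0_0)
  (shift_nbhs_singleton Cc_nbhs0_0)
  (shift_nbhs_nbhs Cc_nbhs0_filter Cc_nbhs0_half).

Lemma Cc_nbhs0E : nbhs (0 : Cc) = Cc_nbhs0.
Proof.
apply/seteqP; split => U.
  by rewrite {1}/nbhs /= /shift_nbhs /=; under [X in Cc_nbhs0 X]eq_set do rewrite add0r.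
by move=> HU; rewrite /nbhs /= /shift_nbhs /=; under eq_set do rewrite add0r.
Qed.

End Cinf.

(* Distributions along the fibres of pi : M * N -> M *)

Lemma vN_bounded0 (R : realType) (V : preTopologicalLmodType R[i]) :
  vN_bounded (set0 : set V).
Proof. by move=> U _; exists 1 => // c _ v. Qed.

Lemma vN_boundedU (R : realType) (V : preTopologicalLmodType R[i])
    (X Y : set V) : vN_bounded X -> vN_bounded Y -> vN_bounded (X `|` Y).
Proof.
move=> bX bY U nU; have [r r0 rX] := bX U nU; have [r' r'0 r'Y] := bY U nU.
exists (r + r'); first exact: addr_gt0.
move=> c rc v [Xv|Yv]; [apply: rX Xv|apply: r'Y Yv]; apply: le_trans rc.
  by rewrite lerDl ltW.
by rewrite lerDr ltW.
Qed.

Section Dual.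
Variables (R : realType) (E E' : normedModType R) (M N : topologicalType).
Variables (A : smooth_structure E M) (B : smooth_structure E' N).
Local Notation C := (Cinf (prod_smooth A B)).

Fact Cinf_act_subproof (f : Cc A) (F : C) :
  (fun z => f z.1 * F z) \in smooth_pred (prod_smooth A B).
Proof.
apply: smooth_predM; last exact: Cinf_smooth.
have /smooth_predP sf := Cc_smooth f.
apply/smooth_predP => _ [c Ac [d Bd <-]]; have [s1 s2] := sf c Ac.
split.
- apply: smooth_onS (smooth_on_fst s1) => -[p q] /=.
  by case.
- apply: smooth_onS (smooth_on_fst s2) => -[p q] /=.
  by case.
Qed.
Definition Cinf_act (f : Cc A) (F : C) : C := MkCinf (Cinf_act_subproof f F).

Definition Edual_pred : {pred C -> Cc A} := fun T =>
  `[< [/\ linear T,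
          forall f F, T (Cinf_act f F) = numul f (T F) &
          continuous T] >].

Lemma Edual_predP T : reflect
  [/\ linear T, forall f F, T (Cinf_act f F) = numul f (T F) & continuous T]
  (T \in Edual_pred).
Proof. exact: asboolP. Qed.

Lemma linear_continuous0 (T : C -> Cc A) : {morph T : F G / F + G} ->
  continuous T <->
  forall U, Cc_nbhs0 U -> Cinf_nbhs0 [set F | U (T F)].
Proof.
move=> TD; have T0 : T 0 = 0 by apply: (@addrI _ (T 0)); rewrite -TD !addr0.
split=> [cT U|HT F U nU].
  by rewrite -Cc_nbhs0E -Cinf_nbhs0E => nU; apply: cT; rewrite T0.
change (Cinf_nbhs0 [set h | U (T (F + h))]).
have -> : [set h | U (T (F + h))] = [set h | [set k | U (T F + k)] (T h)].
  by apply/seteqP; split => h /=; rewrite TD.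
exact: HT.
Qed.

Lemma Cc_nbhs0N U : Cc_nbhs0 U -> @Cc_nbhs0 R E M A [set f | U (- f)].
Proof.
move=> [W [aW WU HW]]; exists W; split => // f Wf; apply: WU.
have := aW (-1) 0 _ _ _ Wf Wf; rewrite scale0r addr0 scaleN1r.
by apply; rewrite normrN1 normr0 addr0.
Qed.

Fact Edual_zmod : zmod_closed Edual_pred.
Proof.
split.
  apply/Edual_predP; split.
  - by move=> k F G /=; rewrite scaler0 addr0.
  - by move=> f F; apply: CcP => x /=; rewrite mulr0.
  - move=> F U /nbhs_singleton U0; change (nbhs F [set _ : C | U 0]).
    by apply: filterS (@filterT _ (nbhs F) _) => G _.
move=> T S /Edual_predP[lT mT cT] /Edual_predP[lS mS cS].
have TD F G : T (F + G) = T F + T G by have := lT 1 F G; rewrite !scale1r.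
have SD F G : S (F + G) = S F + S G by have := lS 1 F G; rewrite !scale1r.
apply/Edual_predP; split.
- move=> k F G; change (T (k *: F + G) - S (k *: F + G) =
    k *: (T F - S F) + (T G - S G)).
  by rewrite lT lS scalerBr opprD addrACA.
- move=> f F; change (T (Cinf_act f F) - S (Cinf_act f F) = numul f (T F - S F)).
  by rewrite mT mS; apply: CcP => x /=; rewrite mulrBr.
- apply/linear_continuous0.
    move=> F G; change (T (F + G) - S (F + G) = T F - S F + (T G - S G)).
    by rewrite TD SD opprD addrACA.
  move=> U /Cc_nbhs0_half[W nW WU].
  have HT := (linear_continuous0 TD).1 cT W nW.
  have HS := (linear_continuous0 SD).1 cS _ (Cc_nbhs0N nW).
  have FF := Cinf_nbhs0_filter (prod_smooth A B).
  apply: (@filterS2 _ _ FF _ _ _ _ HT HS) => F WT WS.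
  exact: (WU (T F) (- S F)).
Qed.
HB.instance Definition _ :=
  GRing.isZmodClosed.Build (C -> Cc A) Edual_pred Edual_zmod.

Record Edual := MkEdual {
  Edual_val :> C -> Cc A ;
  _ : Edual_val \in Edual_pred
}.
HB.instance Definition _ := [isSub for Edual_val].
HB.instance Definition _ := [Choice of Edual by <:].
HB.instance Definition _ := [SubChoice_isSubZmodule of Edual by <:].

Lemma Edual_prop (T : Edual) : (T : C -> Cc A) \in Edual_pred.
Proof. by case: T. Qed.

Lemma EdualP (T S : Edual) : (forall F, T F = S F) -> T = S.
Proof. by move=> TS; apply/val_inj/funext. Qed.

Lemma Edual_sumE I (s : seq I) (T : I -> Edual) F :
  (\sum_(i <- s) T i : Edual) F = \sum_(i <- s) T i F.
Proof.
elim: s => [|i s IH]; first by rewrite !big_nil.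
by rewrite !big_cons -IH.
Qed.

(* The strong topology, of uniform convergence on bounded sets *)
Definition Edual_nbhs0 : set_system Edual := [set U |
  exists (X : set C) (V : set (Cc A)), [/\ vN_bounded X, nbhs (0 : Cc A) V &
    [set T : Edual | forall F, X F -> V (T F)] `<=` U]].

Fact Edual_nbhs0_filter : Filter Edual_nbhs0.
Proof.
split.
- by exists set0, setT; split => //; [exact: vN_bounded0|exact: filterT].
- move=> U U' [X [V [bX nV XU]]] [X' [V' [bX' nV' XU']]].
  exists (X `|` X'), (V `&` V'); split.
  + exact: vN_boundedU.
  + exact: filterI.
  + move=> T HT; split; [apply: XU => F XF|apply: XU' => F XF].
      by have [] := HT F (or_introl XF).
    by have [] := HT F (or_intror XF).
- move=> U U' UU' [X [V [bX nV XU]]]; exists X, V; split => //.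
  exact: subset_trans XU UU'.
Qed.

Fact Edual_nbhs0_0 U : Edual_nbhs0 U -> U 0.
Proof. by move=> [X [V [bX nV XU]]]; apply: XU => F _; exact: nbhs_singleton nV. Qed.

Fact Edual_nbhs0_half U : Edual_nbhs0 U ->
  exists2 W, Edual_nbhs0 W & forall a b, W a -> W b -> U (a + b).
Proof.
move=> [X [V [bX nV XU]]].
have [W nW WV] : exists2 W, Cc_nbhs0 W & forall a b, W a -> W b -> V (a + b).
  by apply: Cc_nbhs0_half; rewrite -Cc_nbhs0E.
exists [set T : Edual | forall F, X F -> W (T F)].
  by exists X, W; split => //; rewrite Cc_nbhs0E.
by move=> T S HT HS; apply: XU => F XF; apply: WV; [exact: HT|exact: HS].
Qed.

HB.instance Definition _ := hasNbhs.Build Edual (shift_nbhs Edual_nbhs0).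
HB.instance Definition _ := Nbhs_isNbhsTopological.Build Edual
  (shift_nbhs_pfilter Edual_nbhs0_filter Edual_nbhs0_0)
  (shift_nbhs_singleton Edual_nbhs0_0)
  (shift_nbhs_nbhs Edual_nbhs0_filter Edual_nbhs0_half).

(* [Edual_bracket y f] is the map F |-> (x |-> f(x) F(x, y)). *)

Lemma smooth_slice (F : C) (y : N) : (fun x => F (x, y)) \in smooth_pred A.
Proof.
have /smooth_predP sF := Cinf_smooth F.
apply/smooth_predP => c Ac; have [d Bd dy] := atlas_cover B y.
have [] : smoothC_on (chart_cod (prod_chart c d))
    ((F : _ -> R[i]) \o chart_inv (prod_chart c d)).
  by apply: sF; exists c => //; exists d.
move=> /(smooth_on_slice (q := d y)) s1 /(smooth_on_slice (q := d y)) s2.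
have e x : chart_inv (prod_chart c d) (x, d y) = (chart_inv c x, y).
  by rewrite /= chart_funK.
split.
- apply: smooth_onS (smooth_on_ext (chart_cod_open c) _ (smooth_onS _ s1)).
  + by [].
  + by move=> x _; rewrite /= chart_funK.
  + by move=> x cx; split => //; exact: chart_funP.
- apply: smooth_onS (smooth_on_ext (chart_cod_open c) _ (smooth_onS _ s2)).
  + by [].
  + by move=> x _; rewrite /= chart_funK.
  + by move=> x cx; split => //; exact: chart_funP.
Qed.

Fact bracket_fun_subproof (y : N) (f : Cc A) (F : C) :
  (fun x => f x * F (x, y)) \in smooth_compact_pred A.
Proof.
apply/andP; split.
  by apply: smooth_predM; [exact: Cc_smooth|exact: smooth_slice].
apply/asboolP; apply: (@tsupport_sub_compact _ _ _ (tsupport f)).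
  exact: Cc_compact.
exact: tsupportM.
Qed.
Definition bracket_fun (y : N) (f : Cc A) (F : C) : Cc A :=
  MkCc (bracket_fun_subproof y f F).

Lemma bracket_jet (y : N) (f : Cc A) c d (F : C) vs x :
  atlas A c -> atlas B d -> chart_dom c x -> chart_dom d y ->
  iter_deriveC vs ((bracket_fun y f F : M -> R[i]) \o chart_inv c) (c x) =
  \sum_(p <- splits vs)
    iter_deriveC p.1 ((f : M -> R[i]) \o chart_inv c) (c x) *
    iter_deriveC [seq (v, 0) | v <- p.2]
      ((F : _ -> R[i]) \o chart_inv (prod_chart c d)) (prod_chart c d (x, y)).
Proof.
move=> Ac Bd cx dy.
have sf : smoothC_on (chart_cod c) ((f : M -> R[i]) \o chart_inv c).
  by move/smooth_predP: (Cc_smooth f) => /(_ c Ac).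
have sF : smoothC_on (chart_cod c) ((fun x => F (x, y)) \o chart_inv c).
  by move/smooth_predP: (smooth_slice F y) => /(_ c Ac).
have ccx : c x \in chart_cod c by rewrite inE; exact: chart_funP.
have := iter_deriveCM (chart_cod_open c) sf sF vs ccx.
move=> ->; apply: eq_bigr => p _; congr (_ * _).
have e : (fun x => F (x, y)) \o chart_inv c = fun q =>
    ((F : _ -> R[i]) \o chart_inv (prod_chart c d)) (q, d y).
  by apply/funext => q /=; rewrite chart_funK.
rewrite e /iter_deriveC; congr (_ +i* _)%C.
  exact: (iter_derive_slice (@complex.Re R \o ((F : _ -> R[i]) \o
    chart_inv (prod_chart c d))) (d y)).
exact: (iter_derive_slice (@complex.Im R \o ((F : _ -> R[i]) \o
  chart_inv (prod_chart c d))) (d y)).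
Qed.

Lemma bracket_nbhs0 (y : N) (f : Cc A) (t : jet_test A) (e : R[i]) : 0 < e ->
  Cinf_nbhs0 [set F : C | jet_lt e t (bracket_fun y f F)].
Proof.
case: t => c K vs Ac cK Kc e0; rewrite /jet_lt /=.
have [d Bd dy] := atlas_cover B y.
pose S (l : seq (seq E * seq E)) (F : C) x := \sum_(p <- l)
    iter_deriveC p.1 ((f : M -> R[i]) \o chart_inv c) (c x) *
    iter_deriveC [seq (v, 0) | v <- p.2]
      ((F : _ -> R[i]) \o chart_inv (prod_chart c d)) (prod_chart c d (x, y)).
have FF := Cinf_nbhs0_filter (prod_smooth A B).
suff H l : forall e' : R[i], 0 < e' -> Cinf_nbhs0 [set F : C |
    forall x, K x -> `|S l F x| < e'].
  apply: (@filterS _ _ FF _ _ _ (H (splits vs) e e0)) => F HF x Kx.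
  by rewrite (@bracket_jet y f c d F vs x Ac Bd (Kc _ Kx) dy); exact: HF.
elim: l => [|p l IH] e' e'0.
  apply: (@filterS _ _ FF _ _ _ (@filterT _ _ FF)) => F _ x Kx.
  by rewrite /S big_nil normr0.
have [b b0 Hb] := jet_bounded p.1 (Cc_smooth f) Ac cK Kc.
have Acd : atlas (prod_smooth A B) (prod_chart c d) by exists c => //; exists d.
have cKy : compact (K `*` [set y]) by apply: compact_setX => //; exact: compact_set1.
have Kycd : K `*` [set y] `<=` chart_dom (prod_chart c d).
  by move=> [x z] [/= /Kc cx ->].
have e'2 : 0 < e' / 2 by rewrite divr_gt0.
have n1 := jet_lt_nbhs0
  (JetTest [seq (v, 0) | v <- p.2] Acd cKy Kycd) (divr_gt0 e'2 b0).
apply: (@filterS2 _ _ FF _ _ _ _ n1 (IH _ e'2)) => F H1 H2 x Kx.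
rewrite /S big_cons (splitr e').
apply: le_lt_trans (ler_normD _ _) _; apply: ltrD; last exact: H2.
have := H1 (x, y) (conj Kx erefl); rewrite normrM /= => H3.
rewrite -(divfK (lt0r_neq0 b0) (e' / 2)) [ltRHS]mulrC.
apply: le_lt_trans (ler_wpM2r _ (Hb x Kx)) _; first exact: normr_ge0.
by rewrite ltr_pM2l.
Qed.

Fact Edual_bracket_subproof (y : N) (f : Cc A) : bracket_fun y f \in Edual_pred.
Proof.
apply/Edual_predP; split.
- by move=> k F G; apply: CcP => x /=; rewrite mulrDr mulrCA.
- by move=> g F; apply: CcP => x /=; rewrite mulrCA.
apply/linear_continuous0; first by move=> F G; apply: CcP => x /=; rewrite mulrDr.
move=> U [W [aW WU HW]].
have FF := Cinf_nbhs0_filter (prod_smooth A B).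
have [P nP HP] := HW _ (Cc_compact (f := f)).
move: nP; rewrite Cinf_nbhs0E => -[s [e [e0 sP]]].
have ns : Cinf_nbhs0 [set F : C | forall t, List.In t s ->
    jet_lt e t (bracket_fun y f F)].
  elim: s {sP} => [|t s IH].
    by apply: (@filterS _ _ FF _ _ _ (@filterT _ _ FF)) => F _ u [].
  apply: (@filterS2 _ _ FF _ _ _ _ (bracket_nbhs0 y f t e0) IH) => F H1 H2 u.
  by move=> [<-|]; [exact: H1|exact: H2].
apply: (@filterS _ _ FF _ _ _ ns) => F HF; apply: WU; apply: HP.
  exact: tsupportM.
exact: sP.
Qed.
Definition Edual_bracket (y : N) (f : Cc A) : Edual := MkEdual (Edual_bracket_subproof y f).

(* Dirac_pi(M * N) *)

Definition Dirac_pred : {pred Edual} := fun T =>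
  `[< exists s : seq (N * Cc A), T = \sum_(p <- s) Edual_bracket p.1 p.2 >].

Lemma bracketN y f : - Edual_bracket y f = Edual_bracket y (- f).
Proof.
apply: EdualP => F; apply: CcP => x.
by change (- (f x * F (x, y)) = - f x * F (x, y)); rewrite mulNr.
Qed.

Fact Dirac_zmod : zmod_closed Dirac_pred.
Proof.
split; first by apply/asboolP; exists [::]; rewrite big_nil.
move=> T S /asboolP[s ->] /asboolP[r ->]; apply/asboolP.
exists (s ++ [seq (p.1, - p.2) | p <- r]); rewrite big_cat big_map /=.
by congr (_ + _); rewrite -sumrN; apply: eq_bigr => p _; rewrite bracketN.
Qed.
HB.instance Definition _ :=
  GRing.isZmodClosed.Build Edual Dirac_pred Dirac_zmod.

Record Dirac := MkDirac { Dirac_val :> Edual ; _ : Dirac_val \in Dirac_pred }.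
HB.instance Definition _ := [isSub for Dirac_val].
HB.instance Definition _ := [Choice of Dirac by <:].
HB.instance Definition _ := [SubChoice_isSubZmodule of Dirac by <:].

HB.instance Definition _ := Topological.copy Dirac (initial_topology Dirac_val).

Lemma DiracP (u v : Dirac) : (forall F, u F = v F) -> u = v.
Proof. by move=> uv; apply/val_inj/EdualP. Qed.

Fact Dirac_bracket_subproof y f : Edual_bracket y f \in Dirac_pred.
Proof. by apply/asboolP; exists [:: (y, f)]; rewrite big_seq1. Qed.
Definition Dirac_bracket y f : Dirac := MkDirac (Dirac_bracket_subproof y f).

Lemma Dirac_act_aux (f : Cc A) (u : Dirac) : exists s : seq (N * Cc A),
  (fun F => u (Cinf_act f F)) = (\sum_(p <- s) Edual_bracket p.1 p.2 : Edual) :> (C -> Cc A).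
Proof.
case: u => u /= /asboolP[s us].
exists [seq (p.1, numul f p.2) | p <- s]; apply/funext => F.
rewrite us big_map !Edual_sumE; apply: eq_bigr => p _.
by apply: CcP => x /=; rewrite mulrCA mulrA.
Qed.

Fact Dirac_act_Edual (f : Cc A) (u : Dirac) :
  (fun F => u (Cinf_act f F)) \in Edual_pred.
Proof. by have [s ->] := Dirac_act_aux f u; exact: Edual_prop. Qed.

Fact Dirac_act_Dirac (f : Cc A) (u : Dirac) :
  MkEdual (Dirac_act_Edual f u) \in Dirac_pred.
Proof.
by apply/asboolP; have [s us] := Dirac_act_aux f u; exists s; exact: val_inj.
Qed.
Definition Dirac_act (f : Cc A) (u : Dirac) : Dirac :=
  MkDirac (Dirac_act_Dirac f u).

Lemma Dirac_actE f u F : Dirac_act f u F = numul f (u F).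
Proof. by have /Edual_predP[_ /(_ f F)] := Edual_prop u. Qed.

Fact Dirac_actA f g u : Dirac_act f (Dirac_act g u) = Dirac_act (numul f g) u.
Proof. by apply: DiracP => F; rewrite !Dirac_actE numulA. Qed.
Fact Dirac_actDl u : {morph Dirac_act^~ u : f g / f + g}.
Proof.
move=> f g; apply: DiracP => F.
change (Dirac_act (f + g) u F = Dirac_act f u F + Dirac_act g u F).
by rewrite !Dirac_actE numulDl.
Qed.
Fact Dirac_actDr f : {morph Dirac_act f : u v / u + v}.
Proof.
move=> u v; apply: DiracP => F.
change (Dirac_act f (u + v) F = Dirac_act f u F + Dirac_act f v F).
rewrite !Dirac_actE; change (numul f (u F + v F) = numul f (u F) + numul f (v F)).
by rewrite numulC numulDl !(numulC f).
Qed.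
HB.instance Definition _ := Zmodule_isNuModule.Build (Cc A) Dirac
  Dirac_actA Dirac_actDl Dirac_actDr.

(* Dirac (x) Dirac with the injective topology *)

Definition Dirac2 := tensor Dirac Dirac.
HB.instance Definition _ := NuModule.on Dirac2.

(* pairing F G is F (x) G, sending u' (x) u'' to u'(F) u''(G). *)
Definition pairing (F G : C) : Dirac2 -> Cc A :=
  tens_lift (fun u v : Dirac => numul (u F) (v G)).

Lemma pairing_balanced (F G : C) :
  balanced (fun u v : Dirac => numul (u F) (v G)).
Proof.
split.
- by move=> v u u'; exact: numulDl.
- move=> u v v'; change (numul (u F) (v G + v' G) =
    numul (u F) (v G) + numul (u F) (v' G)).
  by rewrite numulC numulDl !(numulC (u F)).
- move=> f u v; rewrite [nuact f u F]Dirac_actE [nuact f v G]Dirac_actE.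
  by rewrite numulA (numulC (u F)).
Qed.

Definition Dirac2_nbhs0 : set_system Dirac2 := [set U |
  exists (X Y : set C) (V : set (Cc A)),
    [/\ vN_bounded X, vN_bounded Y, nbhs (0 : Cc A) V &
      [set w : Dirac2 | forall F G, X F -> Y G -> V (pairing F G w)] `<=` U]].

Fact Dirac2_nbhs0_filter : Filter Dirac2_nbhs0.
Proof.
split.
- exists set0, set0, setT; split => //; try exact: vN_bounded0.
  exact: filterT.
- move=> U U' [X [Y [V [bX bY nV H]]]] [X' [Y' [V' [bX' bY' nV' H']]]].
  exists (X `|` X'), (Y `|` Y'), (V `&` V'); split.
  + exact: vN_boundedU.
  + exact: vN_boundedU.
  + exact: filterI.
  + move=> w Hw; split; [apply: H => F G XF YG|apply: H' => F G XF YG].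
      by have [] := Hw F G (or_introl XF) (or_introl YG).
    by have [] := Hw F G (or_intror XF) (or_intror YG).
- move=> U U' UU' [X [Y [V [bX bY nV H]]]]; exists X, Y, V; split => //.
  exact: subset_trans H UU'.
Qed.

Fact Dirac2_nbhs0_0 U : Dirac2_nbhs0 U -> U 0.
Proof.
move=> [X [Y [V [bX bY nV H]]]]; apply: H => F G _ _.
rewrite /pairing tens_lift0; first exact: nbhs_singleton nV.
exact: pairing_balanced.
Qed.

Fact Dirac2_nbhs0_half U : Dirac2_nbhs0 U ->
  exists2 W, Dirac2_nbhs0 W & forall a b, W a -> W b -> U (a + b).
Proof.
move=> [X [Y [V [bX bY nV H]]]].
have [W nW WV] : exists2 W, Cc_nbhs0 W & forall a b, W a -> W b -> V (a + b).
  by apply: Cc_nbhs0_half; rewrite -Cc_nbhs0E.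
exists [set w : Dirac2 | forall F G, X F -> Y G -> W (pairing F G w)].
  by exists X, Y, W; split => //; rewrite Cc_nbhs0E.
move=> w w' Hw Hw'; apply: H => F G XF YG.
rewrite /pairing tens_liftD; last exact: pairing_balanced.
by apply: WV; [exact: Hw|exact: Hw'].
Qed.

HB.instance Definition _ := hasNbhs.Build Dirac2 (shift_nbhs Dirac2_nbhs0).
HB.instance Definition _ := Nbhs_isNbhsTopological.Build Dirac2
  (shift_nbhs_pfilter Dirac2_nbhs0_filter Dirac2_nbhs0_0)
  (shift_nbhs_singleton Dirac2_nbhs0_0)
  (shift_nbhs_nbhs Dirac2_nbhs0_filter Dirac2_nbhs0_half).

(* The families y need not be injective, and e i is any choice of 1_(f i). *)
Definition Dirac_comul_formula (Delta : Dirac -> tensor Dirac Dirac) :=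
  forall (k : nat) (y : 'I_k -> N) (f e : 'I_k -> Cc A),
    (forall i, numul (e i) (f i) = f i) ->
    Delta (\sum_(i < k) Dirac_bracket (y i) (f i)) =
    \sum_(i < k) tens (Dirac_bracket (y i) (f i)) (Dirac_bracket (y i) (e i)).

Definition Dirac_counit_formula (eps : Dirac -> Cc A) :=
  forall (k : nat) (y : 'I_k -> N) (f : 'I_k -> Cc A),
    eps (\sum_(i < k) Dirac_bracket (y i) (f i)) = \sum_(i < k) f i.

End Dual.

(* Main.v *)
Require Import Defs.
From mathcomp Require Import all_boot all_order all_algebra.
From mathcomp Require Import all_classical all_reals all_analysis.
From mathcomp Require Import complex ring.

Set Implicit Arguments.
Unset Strict Implicit.
Unset Printing Implicit Defensive.

Import Order.TTheory GRing.Theory Num.Theory.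
Import numFieldNormedType.Exports.
Local Open Scope classical_set_scope.
Local Open Scope ring_scope.

(** A Dirac distribution is u = sum_i [E_{y_i}, f_i], and everything reduces to
    two facts about smooth functions with compact support, both consequences of
    bump functions.

    Points of N can be separated: given finitely many points of N there is a
    smooth function on N which is 1 at one of them and 0 at the others
    ([separating_function]).  Applying u to such functions, pulled back to
    M * N, recovers the coefficients f_i, so that Delta is well defined; the
    argument is carried out directly in the tensor product in
    [comul_seq_eq0].  Compact subsets of M carry functions in C^oo_c(M) equal
    to 1 on them, so that finitely many functions f_i have one common unit e
    with e f_i = f_i ([Cc_common_unit]); this lets Delta be computed with a
    single e ([Dirac_comulE]), and moving e and f_i across the tensor sign
    gives the coalgebra axioms on generators.

    Continuity is formal.  The counit is evaluation at the constant function 1,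
    u |-> u(1), and the pairing of Delta u with F (x) G is u(F G)
    ([pairing_comul]).  Hence the preimage of a basic neighbourhood K(X, Y, V)
    contains the basic neighbourhood of all u with u(H) in V for H in X Y, and
    X Y is bounded by the Leibniz rule ([vN_bounded_mul]).

    Bump functions are obtained from exp(-1/t) by composition and algebra
    alone: plateau t = flat (flat 1 - flat (t - 1)) / flat (flat 1), with
    flat t = exp(-1/t) for t > 0, is 1 for t <= 1 and 0 for t >= 2, and it is
    evaluated on a multiple of the squared distance in a chart. *)

(** * The function exp(-1/t) *)

Section Flat.
Variable R : realType.
Implicit Types (p : {poly R}) (s t : R).

(** It suffices to bound s^k, and s^k <= (k+1)^k exp(s) because
    exp(s) >= exp(s/(k+1))^k and exp(x) >= x. *)
Lemma poly_expR_bound p :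
  exists2 C, 0 <= C & forall s, 0 <= s -> `|p.[s]| <= C * expR s.
Proof.
have pow k s : 0 <= s -> s ^+ k <= k.+1%:R ^+ k * expR s.
  move=> s0; have k0 : 0 < k.+1%:R :> R by [].
  rewrite -{1}(divfK (lt0r_neq0 k0) s) exprMn mulrC ler_wpM2l ?exprn_ge0//.
  apply: (@le_trans _ _ (expR (s / k.+1%:R) ^+ k)).
    apply: lerXn2r; rewrite ?nnegrE ?expR_ge0 ?divr_ge0//.
    by apply: le_trans (expR_ge1Dx _); rewrite lerDr.
  rewrite -expRM_natl ler_expR.
  rewrite -[leRHS](divfK (lt0r_neq0 k0)) mulrC ler_wpM2l ?divr_ge0// ler_nat//.
exists (\sum_(i < size p) `|p`_i| * i.+1%:R ^+ i).
  by apply: sumr_ge0 => i _; rewrite mulr_ge0 ?exprn_ge0.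
move=> s s0; rewrite horner_coef; apply: le_trans (ler_norm_sum _ _ _) _.
rewrite mulr_suml; apply: ler_sum => i _.
rewrite normrM -mulrA ler_wpM2l ?normr_ge0// ger0_norm ?exprn_ge0//.
exact: pow.
Qed.

(** The functions P(1/t) exp(-1/t), extended by zero to t <= 0: a family closed
    under differentiation that contains exp(-1/t). *)
Definition flat_poly p t : R := if 0 < t then p.[t^-1] * expR (- t^-1) else 0.

(** With s = 1/t, the derivative of P(s) exp(-s) in t is
    s^2 (P(s) - P'(s)) exp(-s). *)
Definition flat_poly_deriv p := 'X^2 * (p - p^`()).

(** Gives the derivative 0 at the origin: P(s) exp(-s) <= C / s^2 is the
    exponential bound for the polynomial s^2 P(s). *)
Lemma flat_poly_sqr_bound p : exists2 C, 0 < C &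
  forall t, `|flat_poly p t| <= C * t ^+ 2.
Proof.
have [C C0 HC] := poly_expR_bound ('X^2 * p).
exists (C + 1) => [|t]; first by rewrite ltr_wpDl.
rewrite /flat_poly; case: ifPn => [t0|_]; last first.
  by rewrite normr0 mulr_ge0 ?sqr_ge0// addr_ge0.
have := HC t^-1; rewrite invr_ge0 ltW// => /(_ isT).
rewrite hornerM hornerXn normrM normrX normfV (gtr0_norm t0) exprVn => H.
rewrite normrM (ger0_norm (expR_ge0 _)) expRN ler_pdivrMr ?expR_gt0//.
move: H; rewrite mulrC ler_pdivrMr ?exprn_gt0// => H; apply: le_trans H _.
by rewrite mulrAC ler_wpM2r ?expR_ge0// ler_wpM2r ?sqr_ge0// lerDl.
Qed.

Lemma is_derive_flat_poly p t :
  is_derive t 1 (flat_poly p) (flat_poly (flat_poly_deriv p) t).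
Proof.
have [t0|t0|->] := ltgtP t 0.
- rewrite {2}/flat_poly ltNge (ltW t0) /=.
  have E1 : \forall x \near t, cst 0 x = flat_poly p x.
    have := lt_nbhsl t0; apply: filterS => x x0.
    by rewrite /flat_poly ltNge (ltW x0).
  apply: (near_eq_is_derive E1).
- rewrite {2}/flat_poly t0.
  have E1 : \forall x \near t, (fun x => p.[x^-1] * expR (- x^-1)) x = flat_poly p x.
    have := lt_nbhsr t0; apply: filterS => x x0.
    by rewrite /flat_poly x0.
  apply: (near_eq_is_derive E1).
  have dV : is_derive t (1 : R) (fun x => x^-1) (- t ^- 2).
    apply: is_derive_eq (@is_deriveV _ id _ _ _ _ (is_derive_id _ _)) _.
      by rewrite gt_eqF.
    by rewrite [LHS]mulr1.
  have H1 := @is_derive1_comp R (horner p) (fun x => x^-1) t _ _ (is_derive_poly _ _) dV.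
  have H2 := @is_derive1_comp R expR (fun x => - x^-1) t _ _ (is_derive_expR _) (is_deriveN dV).
  apply: is_derive_eq (is_deriveM H1 H2) _.
  rewrite /flat_poly_deriv /= !hornerE /GRing.scale /= exprVn. ring.
- rewrite {2}/flat_poly ltxx; have [C C0 HC] := flat_poly_sqr_bound p.
  have f0 : flat_poly p 0 = 0 by rewrite /flat_poly ltxx.
  have H : (fun h : R => h^-1 *: ((flat_poly p \o shift 0) (h *: 1) - flat_poly p 0)) @ 0^' --> (0 : R).
    apply/cvgrPdist_lt => e e0; near=> h.
    rewrite sub0r normrN f0 subr0 /= addr0 normrM normfV [h *: 1]mulr1.
    have h0 : h != 0 by near: h; exact: nbhs_dnbhs_neq.
    rewrite mulrC ltr_pdivrMr ?normr_gt0//.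
    apply: le_lt_trans (HC h) _; rewrite -(real_normK (num_real h)) expr2 mulrA.
    rewrite ltr_pM2r ?normr_gt0// mulrC -ltr_pdivlMr//.
    near: h. apply: dnbhs0_lt. by rewrite divr_gt0.
  by apply: DeriveDef; [exact: cvgP H|exact: cvg_lim H].
Unshelve. all: by end_near. Qed.

End Flat.

(** * Smoothness of compositions *)

Section SmoothComposition.
Variables (R : realType) (E : normedModType R).
Implicit Types (U : set E) (f g s : E -> R).

(** Coinductive proof of smoothness: it is enough to find a class of continuous
    functions that is stable, on U, under directional derivatives.  Unlike an
    induction on the order of differentiation this needs no linearity of
    [iter_derive] for functions not yet known to be smooth. *)
Lemma smooth_on_coind (F : normedModType R) U (P : (E -> F) -> Prop) : open U ->
  (forall f : E -> F, P f -> forall x, U x -> continuous_at x f) ->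
  (forall (f : E -> F) v, P f -> exists2 g, P g & forall x, U x -> is_derive x v f (g x)) ->
  forall f : E -> F, P f -> smooth_on U f.
Proof.
move=> oU Pc Pd f Pf vs.
have [g Pg fg] : exists2 g, P g & {in U, iter_derive vs f =1 g}.
  elim: vs => [|v vs [g Pg fg]]; first by exists f.
  have [h Ph gh] := Pd g v Pg; exists h => // x; rewrite inE => Ux /=.
  rewrite (near_eq_derive (g := g)); first by have [_ ->] := gh x Ux.
  have := open_nbhs_nbhs (conj oU Ux); apply: filterS => y Uy.
  by rewrite fg// inE.
move=> x Ux; have E1 : \forall y \near x, g y = iter_derive vs f y.
  have := open_nbhs_nbhs (conj oU Ux); apply: filterS => y Uy.
  by rewrite fg// inE.
split; first exact: near_eq_continuous E1 (Pc g Pg x Ux).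
move=> v; apply: near_eq_derivable E1 _.
by have [h _ /(_ x Ux) []] := Pd g v Pg.
Qed.

(** A directional derivative of s is a one-variable derivative along a line,
    which reduces the statement to the chain rule on the real line. *)
Lemma is_derive_comp_real (h : R -> R) s x v a b :
  is_derive (s x) 1 h a -> is_derive x v s b -> is_derive x v (h \o s) (a * b).
Proof.
move=> dh ds; pose l t := s (t *: v + x).
have quot (F : normedModType R) (k : E -> F) :
    (fun t : R => t^-1 *: ((k \o shift x) (t *: v) - k x)) =
    (fun t : R => t^-1 *: (((fun u : R => k (u *: v + x)) \o shift 0) (t *: (1 : R))
       - k (0 *: v + x))).
  by apply/funext => t /=; rewrite addr0 scale0r add0r [t *: 1]mulr1.
have transfer (k : E -> R) c :
    is_derive x v k c <-> is_derive (0 : R) (1 : R) (fun u : R => k (u *: v + x)) c.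
  split=> -[d e]; split; move: d e; rewrite /derivable /derive quot //.
apply/transfer; apply: (@is_derive1_comp R h l).
  by rewrite /l scale0r add0r.
exact/transfer.
Qed.

Lemma smooth_on_continuous (F : normedModType R) U (f : E -> F) x :
  smooth_on U f -> U x -> continuous_at x f.
Proof. by move=> sf Ux; have [] := sf [::] x Ux. Qed.

Lemma smooth_on_derive (F : normedModType R) U (f : E -> F) v :
  smooth_on U f -> smooth_on U ('D_v f).
Proof.
move=> sf vs x Ux; have := sf (rcons vs v) x Ux.
by rewrite /iter_derive foldr_rcons.
Qed.

(** The span, over smooth coefficients, of the h^(k) o s, where [hs] is the
    sequence of derivatives of h.  By the chain rule it is stable under
    derivatives, so it serves as the class required by [smooth_on_coind]. *)
Inductive comp_span U s (hs : nat -> R -> R) : (E -> R) -> Prop :=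
| comp_spanM g k : smooth_on U g -> comp_span U s hs (fun x => g x * hs k (s x))
| comp_spanD f g : comp_span U s hs f -> comp_span U s hs g ->
    comp_span U s hs (fun x => f x + g x).

Lemma smooth_on_comp U s (hs : nat -> R -> R) k : open U -> smooth_on U s ->
  (forall k (t : R), is_derive t (1 : R) (hs k) (hs k.+1 t)) ->
  smooth_on U (fun x => hs k (s x)).
Proof.
move=> oU ss dhs.
have e1 : {in U, (fun x => 1 * hs k (s x)) =1 (fun x => hs k (s x))}.
  by move=> x _; rewrite mul1r.
apply: (smooth_on_ext oU e1).
have hs_cont j t : continuous_at t (hs j).
  by apply/differentiable_continuous/derivable1_diffP; have [] := dhs j t.
apply: (@smooth_on_coind _ U (comp_span U s hs) oU); last first.
- by apply: comp_spanM; exact: smooth_on_cst.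
- move=> f v; elim=> {f} [g j sg|f g _ [df Pdf fdf] _ [dg Pdg gdg]].
    exists (fun x => 'D_v g x * hs j (s x) + (g x * 'D_v s x) * hs j.+1 (s x)).
      apply: comp_spanD; apply: comp_spanM; first exact: smooth_on_derive.
      by apply: (smooth_onM oU sg _); exact: smooth_on_derive.
    move=> x Ux; have dg := smooth_on_is_derive [::] v sg Ux.
    have ds := smooth_on_is_derive [::] v ss Ux.
    apply: is_derive_eq (is_deriveM dg (is_derive_comp_real (dhs j (s x)) ds)) _.
    by rewrite /GRing.scale /=; ring.
  exists (fun x => df x + dg x); first exact: comp_spanD.
  by move=> x Ux; apply: is_deriveD; [exact: fdf|exact: gdg].
- move=> f; elim=> {f} [g j sg|f g _ cf _ cg] x Ux; last first.
    by apply: cvgD; [exact: cf|exact: cg].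
  apply: cvgM; first exact: smooth_on_continuous sg Ux.
  apply: (@continuous_comp _ _ _ s); last exact: hs_cont.
  exact: smooth_on_continuous ss Ux.
Qed.

End SmoothComposition.

(** * Plateau functions *)

Section Plateau.
Variable R : realType.

Definition flat : R -> R := flat_poly 1.

Lemma flat_le0 t : t <= 0 -> flat t = 0.
Proof. by move=> t0; rewrite /flat /flat_poly ltNge t0. Qed.

Lemma flat_gt0 t : 0 < t -> flat t = expR (- t^-1).
Proof. by move=> t0; rewrite /flat /flat_poly t0 hornerC mul1r. Qed.

Lemma smooth_on_flat (E : normedModType R) (U : set E) (s : E -> R) :
  open U -> smooth_on U s -> smooth_on U (fun x => flat (s x)).
Proof.
move=> oU ss; pose hs k := flat_poly (iter k (@flat_poly_deriv R) 1).
apply: (@smooth_on_comp _ _ _ s hs 0 oU ss) => k t.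
exact: is_derive_flat_poly.
Qed.

(** For t <= 1 the inner [flat (t - 1)] vanishes, so the quotient is 1; for
    t >= 2 it is at least [flat 1], so the outer [flat] vanishes.  Thus no
    quotient of non-constant functions is involved. *)
Definition plateau t := (flat (flat 1))^-1 * flat (flat 1 - flat (t - 1)).

Lemma plateau1 t : t <= 1 -> plateau t = 1.
Proof.
move=> t1; rewrite /plateau (flat_le0 (t := t - 1)) ?subr_le0// subr0 mulVf//.
by rewrite !flat_gt0 ?expR_gt0// gt_eqF// expR_gt0.
Qed.

Lemma plateau0 t : 2 <= t -> plateau t = 0.
Proof.
move=> t2; have t1 : 1 <= t - 1 by rewrite lerBrDr.
rewrite /plateau (flat_le0 (t := flat 1 - _)) ?mulr0// subr_le0.
have t0 : 0 < t - 1 by apply: lt_le_trans t1.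
by rewrite !flat_gt0// ler_expR lerN2 invr1 invf_le1.
Qed.

Lemma smooth_on_plateau (E : normedModType R) (U : set E) (s : E -> R) :
  open U -> smooth_on U s -> smooth_on U (fun x => plateau (s x)).
Proof.
move=> oU ss; apply: (smooth_onM oU _ _); first exact: smooth_on_cst.
apply: (smooth_on_flat oU _).
have sf : smooth_on U (fun x => flat (s x - 1)).
  apply: (smooth_on_flat oU _).
  have := smooth_on_linR 1 (-1) oU ss (@smooth_on_cst R E R U 1).
  by apply: (smooth_on_ext oU _) => x _; rewrite mul1r mulN1r.
have := smooth_on_linR 1 (-1) oU (@smooth_on_cst R E R U (flat 1)) sf.
by apply: (smooth_on_ext oU _) => x _; rewrite mul1r mulN1r.
Qed.

End Plateau.

(** * Bump functions on manifolds *)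

Section SmoothCoordinates.
Variables (R : realType) (E : normedModType R).

Lemma smooth_on_coord n (U : set E) (f : E -> 'rV[R]_n) i : open U ->
  smooth_on U f -> smooth_on U (fun x => f x 0 i).
Proof.
move=> oU sf.
pose P (h : E -> R) := exists2 g : E -> 'rV[R]_n, smooth_on U g & h = fun x => g x 0 i.
apply: (@smooth_on_coind R E R U P oU); last by exists f.
- move=> _ [g sg ->] x Ux.
  apply: (@continuous_comp _ _ _ g (fun y : 'rV[R]_n => y 0 i)).
    exact: smooth_on_continuous sg Ux.
  exact: coord_continuous.
- move=> _ v [g sg ->]; exists (fun x => 'D_v g x 0 i).
    by exists ('D_v g); [exact: smooth_on_derive|].
  move=> x Ux; have dg := (sg [::] x Ux).2 v.
  split; first exact: ((derivable_mxP g x v).1 dg 0 i).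
  by rewrite (derive_mx dg) mxE.
Qed.

Lemma smooth_on_sum (I : Type) (r : seq I) (U : set E) (f : I -> E -> R) :
  open U -> (forall i, smooth_on U (f i)) ->
  smooth_on U (fun x => \sum_(i <- r) f i x).
Proof.
move=> oU sf; elim: r => [|i r IH].
  by under eq_fun do rewrite big_nil; exact: smooth_on_cst.
have := smooth_on_linR 1 1 oU (sf i) IH.
by apply: (smooth_on_ext oU) => x _; rewrite big_cons !mul1r.
Qed.

End SmoothCoordinates.

Section Bump.
Variables (R : realType) (n : nat) (M : topologicalType).
Variable A : smooth_structure 'rV[R]_n M.
Hypothesis hausdorffM : hausdorff_space M.

Section BumpInChart.
Variables (c0 : chart 'rV[R]_n M) (p : 'rV[R]_n) (rho : R).
Hypotheses (rho0 : 0 < rho) (Ac0 : atlas A c0).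

Local Notation box := [set q : 'rV[R]_n | `|p - q| <= rho].
Hypothesis box_cod : box `<=` chart_cod c0.

(** The factor 2 / rho^2 makes the argument of [plateau] at least 2 as soon as
    one coordinate differs by rho from that of p.  So the support lies in the
    box of radius rho for the sup norm. *)
Definition chart_bump (x : M) : R :=
  if x \in chart_dom c0
  then plateau (2 / rho ^+ 2 * \sum_i (c0 x 0 i - p 0 i) ^+ 2) else 0.

Lemma box_compact : compact (chart_inv c0 @` box).
Proof.
apply: continuous_compact.
  apply: continuous_in_subspaceT => q; rewrite inE => /box_cod.
  exact: chart_inv_continuous.
apply: bounded_closed_compact; last exact: closed_closed_ball_.
exists (`|p| + rho); split; first exact: num_real.
move=> r pr q /= pq; apply: le_trans (ltW pr).
rewrite -[q](subKr p).
by apply: le_trans (ler_normB _ _) _; rewrite lerD2l.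
Qed.

Lemma chart_bump_support x : chart_bump x != 0 -> (chart_inv c0 @` box) x.
Proof.
rewrite /chart_bump; case: ifPn => [|_]; last by rewrite eqxx.
rewrite inE => dx bx; exists (c0 x); last exact: chart_funK.
rewrite /= [leLHS]mx_normrE; apply: bigmax_le => [|[j i] _ /=]; first exact: ltW.
rewrite !mxE (ord1 j) leNgt; apply: contra bx => lt_rho.
rewrite plateau0// mulrAC ler_pdivlMr ?exprn_gt0// ler_pM2l//.
rewrite (bigD1 i)//= -[leLHS]addr0 lerD//; last first.
  by apply: sumr_ge0 => k _; exact: sqr_ge0.
rewrite -(real_normK (num_real (_ - _))) distrC.
by apply: lerXn2r; rewrite ?nnegrE ?normr_ge0 ?(ltW lt_rho) ?(ltW rho0).
Qed.

(** Near a point of the domain of c0 the function is a smooth expression in the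
    transition map.  Elsewhere it vanishes near the point, because the image of
    the box is compact, hence closed in the Hausdorff space M. *)
Lemma chart_bump_smooth c : atlas A c ->
  smooth_on (chart_cod c) (chart_bump \o chart_inv c).
Proof.
move=> Ac vs q cq; have [dq|dq] := pselect (chart_dom c0 (chart_inv c q)).
  have oU := @overlap_open R _ M c c0.
  suff : smooth_on (overlap c c0) (chart_bump \o chart_inv c) by apply.
  have st := atlas_compat Ac Ac0.
  pose h (x : 'rV[R]_n) :=
    plateau (2 / rho ^+ 2 * \sum_i ((c0 \o chart_inv c) x 0 i - p 0 i) ^+ 2).
  have e : {in overlap c c0, h =1 chart_bump \o chart_inv c}.
    by move=> x; rewrite inE => -[_ dx]; rewrite /chart_bump/= mem_set.
  apply: (smooth_on_ext oU e); apply: (smooth_on_plateau oU _).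
  apply: (smooth_onM oU); first exact: smooth_on_cst.
  pose sq i (x : 'rV[R]_n) := ((c0 \o chart_inv c) x 0 i - p 0 i) ^+ 2.
  apply: (@smooth_on_sum R _ _ _ _ sq oU) => i.
  have sd : smooth_on (overlap c c0) (fun x => (c0 \o chart_inv c) x 0 i - p 0 i).
    have := smooth_on_linR 1 (-1) oU (smooth_on_coord i oU st)
      (@smooth_on_cst R _ R _ (p 0 i)).
    by apply: (smooth_on_ext oU) => x _; rewrite mul1r mulN1r.
  exact: (smooth_onM oU sd sd).
have cK : closed (chart_inv c0 @` box).
  exact: compact_closed hausdorffM box_compact.
pose U := [set x | chart_cod c x /\ (~` (chart_inv c0 @` box)) (chart_inv c x)].
have oU : open U.
  rewrite openE => x [cx Kx]; rewrite /interior.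
  have := open_nbhs_nbhs (conj (chart_cod_open c) cx).
  have : nbhs x (chart_inv c @^-1` (~` (chart_inv c0 @` box))).
    apply: (chart_inv_continuous cx).
    by apply: open_nbhs_nbhs; split; [exact: closed_openC|].
  by apply: filterS2 => y Ky cy; split.
suff : smooth_on U (chart_bump \o chart_inv c).
  apply; split => // -[y By yq]; apply: dq; rewrite -yq.
  by apply: chart_invP; exact: box_cod.
have e : {in U, cst 0 =1 chart_bump \o chart_inv c}.
  move=> x; rewrite inE => -[_ Kx] /=; apply/esym/eqP.
  by apply: contrapT => /negP /chart_bump_support.
by apply: (smooth_on_ext oU e); exact: smooth_on_cst.
Qed.

End BumpInChart.

(** The radius e / 2 puts the closed box inside the open ball of radius e, which
    the chart maps into W; [plateau] is 1 near the centre because its argument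
    is continuous and vanishes there. *)
Lemma bump_exists (x0 : M) (W : set M) : nbhs x0 W -> exists b : Cc A,
  (\forall x \near x0, b x = 1) /\ forall x, ~ W x -> b x = 0.
Proof.
move=> nW; have [c0 Ac0 cx0] := atlas_cover A x0; pose p := c0 x0.
have np : nbhs p [set q | chart_cod c0 q /\ W (chart_inv c0 q)].
  have n1 := open_nbhs_nbhs (conj (chart_cod_open c0) (chart_funP cx0)).
  have n2 : nbhs p (chart_inv c0 @^-1` W).
    apply: (chart_inv_continuous (chart_funP cx0)).
    by rewrite chart_funK.
  by apply: filterS2 n1 n2 => q cq Wq.
have [e /= e0 pe] := (@nbhs_ballP R _ p _).1 np.
have rho0 : 0 < e / 2 by rewrite divr_gt0.
have box_in q : `|p - q| <= e / 2 -> chart_cod c0 q /\ W (chart_inv c0 q).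
  move=> pq; apply: pe; rewrite -ball_normE /=; apply: le_lt_trans pq _.
  by rewrite ltr_pdivrMr// mulr_natr mulr2n ltrDl.
have box_cod : [set q | `|p - q| <= e / 2] `<=` chart_cod c0.
  by move=> q /box_in[].
pose b := chart_bump c0 p (e / 2).
have bs : (fun x => (b x)%:C%C) \in smooth_compact_pred A.
  apply/andP; split.
    apply/smooth_predP => c Ac; split; last exact: smooth_on_cst.
    exact: (chart_bump_smooth rho0 Ac0 box_cod Ac).
  apply/asboolP; apply: tsupport_sub_compact (box_compact box_cod) _.
  rewrite [X in _ `<=` X](closure_id _).1; last first.
    exact: compact_closed hausdorffM (box_compact box_cod).
  apply: closure_subset => x /= bx; apply: (chart_bump_support rho0).
  by apply: contra bx => /eqP; rewrite -/b => ->.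
exists (MkCc bs); split => /=; last first.
  move=> x Wx; suff -> : b x = 0 by [].
  apply/eqP; apply: contrapT => /negP /(chart_bump_support rho0)[q /box_in[_ Wq]].
  by move=> qx; apply: Wx; rewrite -qx.
pose k (x : M) := 2 / (e / 2) ^+ 2 * \sum_i (c0 x 0 i - p 0 i) ^+ 2.
have kc : continuous_at x0 k.
  pose sq i x := (c0 x 0 i - p 0 i) ^+ 2.
  suff H i : continuous_at x0 (sq i).
    exact: (cvgM (cvg_cst _) (@Defs.continuous_big R M _ _ sq x0 H)).
  have h : (fun x => c0 x 0 i - p 0 i) @ x0 --> (c0 x0 0 i - p 0 i).
    apply: cvgB; last exact: cvg_cst.
    apply: (@continuous_comp _ _ _ c0 (fun y : 'rV[R]_n => y 0 i)).
      exact: chart_fun_continuous.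
    exact: coord_continuous.
  exact: (cvgM h h).
have k0 : k x0 < 1.
  rewrite /k big1 ?mulr0// => i _; rewrite subrr expr0n//.
have n1 : nbhs x0 [set x | k x < 1] := kc _ (lt_nbhsl k0).
have n2 := open_nbhs_nbhs (conj (chart_dom_open c0) cx0).
apply: filterS (filterI n1 n2) => x [kx dx].
by rewrite /b /chart_bump mem_set// plateau1// ltW.
Qed.

(** 1 - (1 - f)(1 - g), expanded so that it makes sense when C^oo_c(M) has no
    unit: it is 1 wherever f or g is. *)
Definition Cc_join (f g : Cc A) : Cc A := f + g - numul f g.

Lemma Cc_joinE f g x : Cc_join f g x = f x + g x - f x * g x.
Proof. by []. Qed.

(** If no e works, the sets of points of K where e differs from 1 form a proper
    filter base, since [Cc_join] yields intersections.  At a cluster point of it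
    in K, a bump function equal to 1 near that point is a contradiction. *)
Lemma Cc_one_on_compact (K : set M) : compact K ->
  exists e : Cc A, forall x, K x -> e x = 1.
Proof.
move=> cK; apply: contrapT => noe.
pose F : set_system M := [set S | exists e : Cc A, forall x, K x -> e x <> 1 -> S x].
have FF : ProperFilter F.
  split.
    move=> [e He]; apply: noe; exists e => x Kx.
    by apply: contrapT => /(He x Kx).
  split; first by exists 0.
  - move=> S T [e He] [f Hf]; exists (Cc_join e f) => x Kx; rewrite Cc_joinE => ef.
    split; [apply: He|apply: Hf] => // e1; apply: ef; rewrite e1.
      by rewrite mul1r addrK.
    by rewrite mulr1 addrAC subrr add0r.
  - by move=> S T ST [e He]; exists e => x Kx ex; apply: ST; exact: He.
have FK : F K by exists 0.
have [x [Kx xF]] := cK F FF FK.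
have [b [b1 _]] := @bump_exists x setT filterT.
have Fb : F [set y | b y <> 1] by exists b.
by have [y [/= ? ?]] := xF _ _ Fb b1.
Qed.

Lemma Cc_common_unit (fs : seq (Cc A)) :
  exists e : Cc A, forall f, f \in fs -> numul e f = f.
Proof.
elim: fs => [|f fs [e He]]; first by exists 0.
have [d Hd] := Cc_one_on_compact (Cc_compact (f := f)).
have df : numul d f = f.
  apply: CcP => x /=; have [->|fx] := eqVneq (f x) 0; first by rewrite mulr0.
  by rewrite Hd ?mul1r//; exact: subset_closure.
have jl (g h k : Cc A) : numul g k = k \/ numul h k = k -> numul (Cc_join g h) k = k.
  move=> gh; apply: CcP => x; change (Cc_join g h x * k x = k x).
  rewrite Cc_joinE mulrBl mulrDl.
  have [] := gh => /(congr1 (fun u : Cc A => u x)) /= gk.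
    by rewrite mulrAC gk mulrC addrK.
  by rewrite -mulrA gk addrAC subrr add0r.
exists (Cc_join d e) => g; rewrite inE => /orP[/eqP->|gfs]; apply: jl.
  by left.
by right; exact: He.
Qed.

(** Finite subsets of a Hausdorff space are closed, so that x0 has a neighbourhood
    avoiding the other points of s; a bump function supported there will do. *)
Lemma separating_function (x0 : M) (s : seq M) : exists G : Cinf A,
  G x0 = 1 /\ forall x, x \in s -> x != x0 -> G x = 0.
Proof.
have nW : nbhs x0 [set x | x \in s -> x = x0].
  elim: s => [|y s IH]; first exact: filterE.
  have [->|yx0] := eqVneq y x0.
    by apply: filterS IH => x xs /=; rewrite inE => /orP[/eqP//|/xs].
  have oy : open (~` [set y]).
    apply: closed_openC; apply: accessible_closed_set1.
    exact: hausdorff_accessible.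
  have ny : nbhs x0 (~` [set y]).
    by apply: open_nbhs_nbhs; split => // e; rewrite e eqxx in yx0.
  apply: filterS2 ny IH => x xy xs /=; rewrite inE => /orP[/eqP//|/xs//].
have [b [b1 b0]] := bump_exists nW; exists (Cc_incl b); split.
  exact: (nbhs_singleton b1).
by move=> x xs /eqP xx0; apply: b0 => /(_ xs).
Qed.

End Bump.

(** * Tensor products *)

Section TensorLemmas.
Variables (R : nuComRingType) (V W : nuModType R).

Lemma tensDl (a a' : V) (b : W) : tens (a + a') b = tens a b + tens a' b.
Proof. by rewrite [RHS]tens_add_class; apply/tens_classP; exact: tens_Dl. Qed.

Lemma tensDr (a : V) (b b' : W) : tens a (b + b') = tens a b + tens a b'.
Proof. by rewrite [RHS]tens_add_class; apply/tens_classP; exact: tens_Dr. Qed.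

Lemma tens_nuact (r : R) (a : V) (b : W) : tens (nuact r a) b = tens a (nuact r b).
Proof. by apply/tens_classP; exact: tens_mid. Qed.

Lemma nuact_tens (r : R) (a : V) (b : W) : nuact r (tens a b) = tens (nuact r a) b.
Proof. exact: tens_act_class. Qed.

Lemma tens0l (b : W) : tens (0 : V) b = 0.
Proof. by apply/tens_classP; exact: tens_0l. Qed.

Lemma tensNl (a : V) (b : W) : tens (- a) b = - tens a b.
Proof. by apply: (@addrI _ (tens a b)); rewrite -tensDl !subrr tens0l. Qed.

Lemma tens_suml I (s : seq I) (F : I -> V) (b : W) :
  tens (\sum_(i <- s) F i) b = \sum_(i <- s) tens (F i) b.
Proof.
elim: s => [|i s IH]; first by rewrite !big_nil tens0l.
by rewrite !big_cons tensDl IH.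
Qed.

Lemma tens_lift_sum (Z : zmodType) (f : V -> W -> Z) I (s : seq I) a b :
  balanced f ->
  tens_lift f (\sum_(i <- s) tens (a i) (b i)) = \sum_(i <- s) f (a i) (b i).
Proof.
move=> bf; elim: s => [|i s IH]; first by rewrite !big_nil tens_lift0.
by rewrite !big_cons tens_liftD// tens_lift_tens// IH.
Qed.

End TensorLemmas.

Section Balanced.
Variables (R : nuComRingType) (V W : nuModType R).

Lemma balanced_tens_map (V' W' : nuModType R) (f : V -> V') (g : W -> W') :
  nu_linear f -> nu_linear g -> balanced (fun a b => tens (f a) (g b)).
Proof.
move=> [fD fZ] [gD gZ]; split.
- by move=> b a a' /=; rewrite fD tensDl.
- by move=> a b b' /=; rewrite gD tensDr.
- by move=> r a b; rewrite fZ gZ tens_nuact.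
Qed.

Lemma balanced_flip : balanced (fun (a : V) (b : W) => tens b a).
Proof.
split.
- by move=> b a a' /=; rewrite tensDr.
- by move=> a b b' /=; rewrite tensDl.
- by move=> r a b; rewrite tens_nuact.
Qed.

Lemma balanced_tensl (U : nuModType R) (a : U) :
  balanced (fun (b : V) (c : W) => tens (tens a b) c).
Proof.
split.
- by move=> c b b' /=; rewrite tensDr tensDl.
- by move=> b c c' /=; rewrite tensDr.
- by move=> r b c; rewrite -[RHS]tens_nuact nuact_tens tens_nuact.
Qed.

Lemma balanced_assoc (U : nuModType R) :
  balanced (fun (a : U) => tens_lift (fun (b : V) (c : W) => tens (tens a b) c)).
Proof.
split.
- elim/tensW=> s a a' /=; rewrite !tens_lift_class; try exact: balanced_tensl.
  by rewrite -big_split /=; apply: eq_bigr => p _; rewrite !tensDl.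
- by move=> a x y; rewrite tens_liftD//; exact: balanced_tensl.
- move=> r a; elim/tensW=> s; rewrite [nuact r _ in RHS]tens_act_class.
  rewrite !tens_lift_class; try exact: balanced_tensl.
  by rewrite big_map; apply: eq_bigr => p _; rewrite /= tens_nuact.
Qed.

Lemma balanced_unitl :
  balanced (fun (r : nu_regular R) (a : V) => nuact (r : R) a).
Proof.
split.
- by move=> a r r'; exact: nuactDl.
- by move=> r a a'; exact: nuactDr.
- by move=> q r a; rewrite nuactA numulC.
Qed.

Lemma balanced_unitr :
  balanced (fun (a : V) (r : nu_regular R) => nuact (r : R) a).
Proof.
split.
- by move=> r a a'; exact: nuactDr.
- by move=> a r r'; exact: nuactDl.
- by move=> q a r; rewrite nuactA numulC.
Qed.

End Balanced.

(** * The coalgebra of Dirac distributions *)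

Section DiracCoalgebra.
Variables (R : realType) (m n : nat) (M N : topologicalType).
Variables (A : smooth_structure 'rV[R]_m M) (B : smooth_structure 'rV[R]_n N).
Hypotheses (hausdorffM : hausdorff_space M) (hausdorffN : hausdorff_space N).

Local Notation C := (Cinf (prod_smooth A B)).
Local Notation D := (Dirac A B).
Local Notation br := (@Dirac_bracket R _ _ M N A B).
Local Notation Cc := (Cc A).
Implicit Types (y : N) (f g e : Cc) (s : seq (N * Cc)) (u v : D) (F G : C).

Lemma bracketD y f g : br y (f + g) = br y f + br y g.
Proof. by apply: DiracP => F; apply: CcP => x; exact: mulrDl. Qed.

Lemma bracket0 y : br y 0 = 0.
Proof. by apply: (@addrI _ (br y 0)); rewrite -bracketD !addr0. Qed.

Lemma bracket_opp y f : br y (- f) = - br y f.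
Proof. by apply: (@addrI _ (br y f)); rewrite -bracketD !subrr bracket0. Qed.

Lemma bracket_sum y I (r : seq I) (f : I -> Cc) :
  br y (\sum_(i <- r) f i) = \sum_(i <- r) br y (f i).
Proof.
elim: r => [|i r IH]; first by rewrite !big_nil bracket0.
by rewrite !big_cons bracketD IH.
Qed.

Lemma nuact_bracket g y f : nuact g (br y f) = br y (numul g f).
Proof.
by apply: DiracP => F; rewrite [LHS]Dirac_actE; apply: CcP => x; exact: mulrA.
Qed.

Definition dirac_sum s : D := \sum_(p <- s) br p.1 p.2.

Lemma Dirac_val_sum I (r : seq I) (w : I -> D) :
  Dirac_val (\sum_(i <- r) w i) = \sum_(i <- r) Dirac_val (w i).
Proof.
elim: r => [|i r IH]; first by rewrite !big_nil.
by rewrite !big_cons -IH.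
Qed.

Lemma dirac_sum_surj u : exists s, u = dirac_sum s.
Proof.
case: u => u uD; have /asboolP[s us] := uD; exists s; apply: val_inj => /=.
by rewrite us Dirac_val_sum.
Qed.

Lemma Dirac_sumE I (r : seq I) (w : I -> D) F :
  (\sum_(i <- r) w i : D) F = \sum_(i <- r) w i F.
Proof. by rewrite Dirac_val_sum Edual_sumE. Qed.

(** Functions of y alone, on which a Dirac distribution takes the value
    sum_i G(y_i) f_i; these suffice to determine the f_i. *)
Fact pullback_subproof (G : Cinf B) :
  (fun z : M * N => G z.2) \in smooth_pred (prod_smooth A B).
Proof.
have /smooth_predP sG := Cinf_smooth G.
apply/smooth_predP => _ [c Ac [d Bd <-]]; have [s1 s2] := sG d Bd.
split.
- by apply: smooth_onS (smooth_on_snd s1) => -[p q] [].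
- by apply: smooth_onS (smooth_on_snd s2) => -[p q] [].
Qed.
Definition pullback (G : Cinf B) : C := MkCinf (pullback_subproof G).

Lemma dirac_sum_pullback s (G : Cinf B) :
  dirac_sum s (pullback G) = \sum_(p <- s) G p.1 *: p.2.
Proof.
rewrite Dirac_sumE; apply: eq_bigr => p _.
by apply: CcP => x; exact: mulrC.
Qed.

Definition comul_seq e s : tensor D D :=
  \sum_(p <- s) tens (br p.1 p.2) (br p.1 e).

(** With G_y separating y from the other points of the list, each term is
    rewritten as the sum over y of [E_y, G_y(y_i) f_i] (x) [E_y, e].  After
    exchanging the sums, the first factor is [E_y, f] with f the value at G_y
    of the given distribution, which is 0. *)
Lemma comul_seq_eq0 e s : dirac_sum s = 0 -> comul_seq e s = 0.
Proof.
move=> s0; pose ys := undup [seq p.1 | p <- s].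
have sepP y := separating_function B hausdorffN y ys.
pose G y := projT1 (cid (sepP y)).
have G1 y : G y y = 1 by rewrite /G; case: cid => ? [].
have G0 y z : z \in ys -> z != y -> G y z = 0 by rewrite /G; case: cid => ? [? +]; exact.
have -> : comul_seq e s = \sum_(p <- s) \sum_(y <- ys)
    tens (br y (G y p.1 *: p.2)) (br y e).
  rewrite /comul_seq big_seq [RHS]big_seq; apply: eq_bigr => p ps.
  have py : p.1 \in ys by rewrite mem_undup map_f.
  rewrite (bigD1_seq p.1) ?undup_uniq//= G1 scale1r big1 ?addr0// => y yp.
  by rewrite G0 1?eq_sym// scale0r bracket0 tens0l.
rewrite exchange_big big1 // => y _.
rewrite -tens_suml -bracket_sum -dirac_sum_pullback s0.
by rewrite [X in br y X](_ : _ = 0) ?bracket0 ?tens0l.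
Qed.

Lemma comul_seq_wd e s t : dirac_sum s = dirac_sum t -> comul_seq e s = comul_seq e t.
Proof.
move=> st; pose r := s ++ [seq (p.1, - p.2) | p <- t].
have r0 : dirac_sum r = 0.
  rewrite /dirac_sum big_cat big_map /= -[X in X + _]/(dirac_sum s) st.
  by under eq_bigr do rewrite bracket_opp; rewrite sumrN subrr.
have := comul_seq_eq0 e r0; rewrite /comul_seq big_cat big_map /=.
under [X in _ + X = _]eq_bigr do rewrite bracket_opp tensNl.
by rewrite sumrN => /eqP; rewrite subr_eq0 => /eqP.
Qed.

(** Both sides equal [E_y, f] (x) [E_y, d] for d a common unit of e and e':
    write e = e d, move e to the left factor and use e f = f. *)
Lemma tens_bracket_unit y f e e' : numul e f = f -> numul e' f = f ->
  tens (br y f) (br y e) = tens (br y f) (br y e').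
Proof.
move=> ef e'f; have [d Hd] := Cc_common_unit hausdorffM [:: e; e'].
have aux k : k \in [:: e; e'] -> numul k f = f ->
    tens (br y f) (br y k) = tens (br y f) (br y d).
  move=> /Hd dk kf; rewrite -dk numulC -nuact_bracket -tens_nuact.
  by rewrite nuact_bracket kf.
by rewrite (aux e) ?(aux e') ?inE ?eqxx ?orbT.
Qed.

Lemma comul_seq_unit e e' s :
  (forall p, p \in s -> numul e p.2 = p.2) ->
  (forall p, p \in s -> numul e' p.2 = p.2) -> comul_seq e s = comul_seq e' s.
Proof.
move=> He He'; rewrite /comul_seq big_seq [RHS]big_seq.
by apply: eq_bigr => p ps; apply: tens_bracket_unit; [exact: He|exact: He'].
Qed.

Lemma seq_common_unit s : exists e, forall p, p \in s -> numul e p.2 = p.2.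
Proof.
have [e He] := Cc_common_unit hausdorffM [seq p.2 | p <- s].
by exists e => p ps; apply: He; exact: map_f.
Qed.

(** Defined from an arbitrary representation; [Dirac_comulE] is the property
    that makes it usable. *)
Definition Dirac_comul u : tensor D D :=
  let s := projT1 (cid (dirac_sum_surj u)) in
  comul_seq (projT1 (cid (seq_common_unit s))) s.

Lemma Dirac_comulE e s : (forall p, p \in s -> numul e p.2 = p.2) ->
  Dirac_comul (dirac_sum s) = comul_seq e s.
Proof.
move=> He; rewrite /Dirac_comul; case: cid => t /= st; case: cid => d /= Hd.
have [k Hk] := seq_common_unit (s ++ t).
rewrite (@comul_seq_unit d k t) //; last by move=> p pt; rewrite Hk// mem_cat pt orbT.
rewrite -(comul_seq_wd k st); apply: comul_seq_unit => // p ps.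
by rewrite Hk// mem_cat ps.
Qed.

Definition Dirac_counit u : Cc := u (pullback (MkCinf (smooth_pred_cst B 1))).

Lemma Dirac_counit_bracket y f : Dirac_counit (br y f) = f.
Proof. by apply: CcP => x; exact: mulr1. Qed.

Lemma Dirac_comul_bracket y f e : numul e f = f ->
  Dirac_comul (br y f) = tens (br y f) (br y e).
Proof.
move=> ef; have := @Dirac_comulE e [:: (y, f)].
rewrite /dirac_sum /comul_seq !big_seq1; apply=> p.
by rewrite inE => /eqP->.
Qed.

Lemma Dirac_comulD : {morph Dirac_comul : u v / u + v}.
Proof.
move=> u v; have [s us] := dirac_sum_surj u; have [t vt] := dirac_sum_surj v.
have [e He] := seq_common_unit (s ++ t).
have uv : u + v = dirac_sum (s ++ t) by rewrite us vt /dirac_sum big_cat.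
rewrite uv (Dirac_comulE He) us vt (@Dirac_comulE e s) ?(@Dirac_comulE e t).
- by rewrite /comul_seq big_cat.
- by move=> p pt; rewrite He// mem_cat pt orbT.
- by move=> p pt; rewrite He// mem_cat pt.
Qed.

Lemma Dirac_comul_sum I (r : seq I) (w : I -> D) :
  Dirac_comul (\sum_(i <- r) w i) = \sum_(i <- r) Dirac_comul (w i).
Proof.
elim: r => [|i r IH]; last by rewrite !big_cons Dirac_comulD IH.
rewrite !big_nil; apply: (@addrI _ (Dirac_comul 0)).
by rewrite -Dirac_comulD !addr0.
Qed.

Lemma Dirac_comul_linear : nu_linear Dirac_comul.
Proof.
split; first exact: Dirac_comulD.
move=> g u; have [s ->] := dirac_sum_surj u; have [e He] := seq_common_unit s.
rewrite (Dirac_comulE He) /dirac_sum /comul_seq !nuact_sum Dirac_comul_sum.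
rewrite big_seq [RHS]big_seq; apply: eq_bigr => p ps.
rewrite nuact_tens nuact_bracket (@Dirac_comul_bracket _ _ e)//.
by rewrite numulA (numulC e) -numulA He.
Qed.

Lemma Dirac_counit_linear : nu_linear (Dirac_counit : D -> nu_regular Cc).
Proof. by split=> [u v|g u]; [|exact: Dirac_actE]. Qed.

Lemma Dirac_coalgebra :
  is_coalgebra Dirac_comul (Dirac_counit : D -> nu_regular Cc).
Proof.
have idl : nu_linear (id : D -> D) by [].
have Dl := Dirac_comul_linear; have el := Dirac_counit_linear.
have repr u : exists s e, (forall p, p \in s -> numul e p.2 = p.2) /\
    u = dirac_sum s.
  have [s us] := dirac_sum_surj u; have [e He] := seq_common_unit s.
  by exists s, e.
split.
- exact: Cc_common_unit.
- move=> us; elim: us => [|u us [e He]]; first by exists 0.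
  have [s [d [Hd us']]] := repr u.
  have [k Hk] := Cc_common_unit hausdorffM [:: e; d].
  have [ke kd] : numul k e = e /\ numul k d = d.
    by split; apply: Hk; rewrite !inE eqxx ?orbT.
  exists k => v; rewrite inE => /orP[/eqP->|/He ev].
    rewrite us' /dirac_sum nuact_sum big_seq [RHS]big_seq.
    by apply: eq_bigr => p ps; rewrite nuact_bracket -(Hd p ps) numulA kd.
  by rewrite -ev nuactA ke.
- exact: Dl.
- exact: el.
- move=> u; have [s [e [He ->]]] := repr u; rewrite (Dirac_comulE He).
  rewrite /tens_map tens_lift_sum; last exact: balanced_tens_map.
  rewrite /tens_unitr tens_lift_sum; last exact: balanced_unitr.
  rewrite /dirac_sum big_seq [RHS]big_seq; apply: eq_bigr => p ps.
  by rewrite Dirac_counit_bracket nuact_bracket He.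
- move=> u; have [s [e [He ->]]] := repr u; rewrite (Dirac_comulE He).
  rewrite /tens_map tens_lift_sum; last exact: balanced_tens_map.
  rewrite /tens_unitl tens_lift_sum; last exact: balanced_unitl.
  rewrite /dirac_sum big_seq [RHS]big_seq; apply: eq_bigr => p ps.
  by rewrite Dirac_counit_bracket nuact_bracket numulC He.
- move=> u; have [s [e [He ->]]] := repr u; rewrite (Dirac_comulE He).
  rewrite /tens_map !tens_lift_sum; try exact: balanced_tens_map.
  rewrite /tens_assoc tens_lift_sum; last exact: balanced_assoc.
  have [d Hd] := Cc_common_unit hausdorffM [:: e].
  have de : numul d e = e by apply: Hd; rewrite inE.
  rewrite big_seq [RHS]big_seq; apply: eq_bigr => p ps.
  rewrite (Dirac_comul_bracket p.1 de) (Dirac_comul_bracket p.1 (He p ps)).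
  rewrite tens_lift_tens; last exact: balanced_tensl.
  (* With T = [E_y, f] (x) [E_y, e], one has T (x) [E_y, d] = e T (x) [E_y, d]
     = T (x) [E_y, e d], and e d = e. *)
  rewrite -{3}de numulC -nuact_bracket -[RHS]tens_nuact nuact_tens.
  by rewrite nuact_bracket He.
Qed.

(** Since [E_y, f] = f [E_y, e], the function f can be moved from one factor of
    [E_y, f] (x) [E_y, e] to the other. *)
Lemma Dirac_comul_cocommutative : cocommutative Dirac_comul.
Proof.
move=> u; have [s ->] := dirac_sum_surj u; have [e He] := seq_common_unit s.
rewrite (Dirac_comulE He) /tens_flip tens_lift_sum; last exact: balanced_flip.
rewrite /comul_seq big_seq [RHS]big_seq; apply: eq_bigr => p ps.
have -> : br p.1 p.2 = nuact p.2 (br p.1 e) by rewrite nuact_bracket numulC He.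
by rewrite tens_nuact.
Qed.

(** * Continuity of the structure maps *)

Fact Cinf_mul_subproof F G : (fun z => F z * G z) \in smooth_pred (prod_smooth A B).
Proof. by apply: smooth_predM; exact: Cinf_smooth. Qed.
Definition Cinf_mul F G : C := MkCinf (Cinf_mul_subproof F G).

(** On a generator this is f F(., y) e G(., y) = f (F G)(., y).  Continuity of
    Delta is a consequence. *)
Lemma pairing_comul F G u : pairing F G (Dirac_comul u) = u (Cinf_mul F G).
Proof.
have [s ->] := dirac_sum_surj u; have [e He] := seq_common_unit s.
rewrite (Dirac_comulE He) /pairing tens_lift_sum; last exact: pairing_balanced.
rewrite Dirac_sumE big_seq [RHS]big_seq; apply: eq_bigr => p ps.
apply: CcP => x; have /(congr1 (fun f : Cc => f x)) /= ef := He p ps.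
change (p.2 x * F (x, p.1) * (e x * G (x, p.1)) = p.2 x * (F (x, p.1) * G (x, p.1))).
by rewrite -{2}ef; ring.
Qed.

(** Von Neumann boundedness is absorption by multiples of basic neighbourhoods,
    and these are defined by strict bounds on finitely many jets; rescaling
    turns one formulation into the other. *)
Lemma vN_bounded_jetP (X : set C) : vN_bounded X <->
  forall t : jet_test (prod_smooth A B), exists2 b : R[i], 0 < b &
    forall F, X F -> jet_lt b t F.
Proof.
split=> [bX t|HX U].
  have [|r r0 Xr] := bX [set F | jet_lt 1 t F].
    by rewrite Cinf_nbhs0E; exact: jet_lt_nbhs0.
  exists r => // F XF; have [|G tG <-] := Xr r _ F XF; first by rewrite gtr0_norm.
  have rn0 : r != 0 by rewrite gt_eqF.
  by have := jet_ltZ rn0 tG; rewrite mulr1 gtr0_norm.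
rewrite Cinf_nbhs0E => -[ts [d [d0 tsU]]].
have [b b0 Hb] : exists2 b : R[i], 0 < b &
    forall t, List.In t ts -> forall F, X F -> jet_lt b t F.
  elim: ts {tsU} => [|t ts [b b0 Hb]]; first by exists 1.
  have [b' b'0 Hb'] := HX t; exists (b + b'); first exact: addr_gt0.
  move=> t' [<-|tts] F XF.
    by apply: (jet_ltW (e := b')); [rewrite lerDr ltW|exact: Hb'].
  by apply: (jet_ltW (e := b)); [rewrite lerDl ltW|exact: Hb].
exists (b / d); first exact: divr_gt0.
move=> c bdc F XF; have c0 : 0 < `|c| by apply: lt_le_trans bdc; exact: divr_gt0.
have cn0 : c != 0 by rewrite -normr_gt0.
exists (c^-1 *: F); last by rewrite scalerA mulfV// scale1r.
apply: tsU => t tts; apply: (@jet_ltW _ _ _ _ (`|c^-1| * b)).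
  by rewrite normfV mulrC ler_pdivrMr// mulrC -ler_pdivrMr.
by apply: jet_ltZ; [rewrite invr_eq0|exact: Hb].
Qed.

(** By the Leibniz rule a jet of F G is a finite sum of products of jets of F
    and of G over the same compact set. *)
Lemma vN_bounded_mul (X Y : set C) : vN_bounded X -> vN_bounded Y ->
  vN_bounded [set H | exists2 F, X F & exists2 G, Y G & H = Cinf_mul F G].
Proof.
move=> /vN_bounded_jetP bX /vN_bounded_jetP bY; apply/vN_bounded_jetP => t.
case: t => c K vs Ac cK Kc.
pose test ws := JetTest ws Ac cK Kc.
pose jet ws (F : C) z := iter_deriveC ws ((F : _ -> R[i]) \o chart_inv c) (c z).
have [b b0 Hb] : exists2 b : R[i], 0 < b & forall F G, X F -> Y G ->
    forall z, K z -> `|\sum_(p <- splits vs) jet p.1 F z * jet p.2 G z| < b.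
  elim: (splits vs) => [|p l [b b0 Hb]].
    by exists 1 => // F G _ _ z _; rewrite big_nil normr0.
  have [a a0 Ha] := bX (test p.1); have [a' a'0 Ha'] := bY (test p.2).
  exists (a * a' + b); first by rewrite addr_gt0 ?mulr_gt0.
  move=> F G XF YG z Kz; rewrite big_cons.
  apply: le_lt_trans (ler_normD _ _) _; apply: ltrD; last exact: Hb.
  rewrite normrM; apply: ltr_pM; rewrite ?normr_ge0//.
    exact: (Ha F XF z Kz).
  exact: (Ha' G YG z Kz).
exists b => // _ [F XF [G YG ->]] z Kz.
have cz : c z \in chart_cod c by rewrite inE; apply: chart_funP; exact: (Kc z Kz).
have e := iter_deriveCM (chart_cod_open c) (jet_iter_deriveC F Ac)
  (jet_iter_deriveC G Ac) vs cz.
by have := Hb F G XF YG z Kz; rewrite /jet -e.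
Qed.

Lemma vN_bounded_set1 F : vN_bounded [set F].
Proof.
apply/vN_bounded_jetP => -[c K vs Ac cK Kc].
have [b b0 Hb] := jet_bounded vs (Cinf_smooth F) Ac cK Kc.
exists (b + 1); first exact: addr_gt0.
by move=> _ -> z Kz; apply: le_lt_trans (Hb z Kz) _; rewrite ltrDl.
Qed.

(** Turns the topology of the Dirac distributions, induced and translated, into
    the form in which both structure maps are tested for continuity. *)
Lemma Dirac_nbhs u (X : set C) (V : set Cc) : vN_bounded X -> nbhs (0 : Cc) V ->
  nbhs u [set v | forall F, X F -> V ((v - u : D) F)].
Proof.
move=> bX nV; pose T := [set S : Edual A B | forall F, X F -> V ((S - Dirac_val u) F)].
have nT : nbhs (Dirac_val u) T.
  exists X, V; split => // S HS F XF; rewrite addrC addKr; exact: HS.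
by have := @initial_continuous D (Edual A B) (@Dirac_val R _ _ M N A B) u T nT.
Qed.

Lemma Dirac_comul_continuous : continuous (Dirac_comul : D -> Dirac2 A B).
Proof.
move=> u U [X [Y [V [bX bY nV XYV]]]].
apply: filterS (Dirac_nbhs u (vN_bounded_mul bX bY) nV) => v Hv.
have uv : Dirac_comul v = Dirac_comul u + Dirac_comul (v - u).
  by rewrite -Dirac_comulD addrC subrK.
rewrite /= uv; apply: XYV => F G XF YG; rewrite pairing_comul; apply: Hv.
by exists F => //; exists G.
Qed.

Lemma Dirac_counit_continuous : continuous Dirac_counit.
Proof.
move=> u U nU; pose one := pullback (MkCinf (smooth_pred_cst B 1)).
have nV : nbhs (0 : Cc) [set h | U (Dirac_counit u + h)].
  by rewrite Cc_nbhs0E; exact: nU.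
apply: filterS (Dirac_nbhs u (vN_bounded_set1 one) nV) => v /(_ one erefl) Hv.
rewrite /preimage /=.
have -> : Dirac_counit v = Dirac_counit u + (v - u : D) one.
  by change (v one = u one + (v one - u one)); rewrite addrC subrK.
exact: Hv.
Qed.

End DiracCoalgebra.

(* Delta and eps are uniquely determined by the two formulas: every element of
   Dirac A B is a finite sum of elements Dirac_bracket y f, and each f in Cc A
   has an e in Cc A with e f = f. *)
Theorem proposition4p1 (R : realType) (m n : nat) (M N : topologicalType)
    (A : smooth_structure 'rV[R]_m M) (B : smooth_structure 'rV[R]_n N)
    (hausdorffM : hausdorff_space M) (hausdorffN : hausdorff_space N)
    (countableM : @second_countable M) (countableN : @second_countable N) :
  exists (Delta : Dirac A B -> tensor (Dirac A B) (Dirac A B))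
         (eps : Dirac A B -> Cc A),
    [/\ Dirac_comul_formula Delta, Dirac_counit_formula eps,
        is_coalgebra Delta (eps : Dirac A B -> nu_regular (Cc A)),
        cocommutative Delta &
        continuous (Delta : Dirac A B -> Dirac2 A B) /\ continuous eps].
Proof.
exists (Dirac_comul hausdorffM), (@Dirac_counit R m n M N A B); split.
- move=> k y f e ef; rewrite (Dirac_comul_sum _ hausdorffN).
  by apply: eq_bigr => i _; exact: Dirac_comul_bracket.
- move=> k y f; rewrite /Dirac_counit Dirac_sumE.
  by apply: eq_bigr => i _; exact: Dirac_counit_bracket.
- exact: Dirac_coalgebra.
- exact: Dirac_comul_cocommutative.
- split; first exact: Dirac_comul_continuous.
  exact: Dirac_counit_continuous.
Qed.
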